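(* Let $v$ be the value function. There exists a measurable function $b^{*}:[0,\infty)\to[0,1]$ such that for all $z\geq 0$ $$\inf_{b\in[0,1]} \mathbb E\bigl[e^{-rT_1}\,v(\Delta_z^b(T_1))\bigr] = \mathbb E\bigl[e^{-rT_1}\,v(\Delta_z^{b^{*}(z)}(T_1))\bigr],$$ where $\Delta_z^b$ denotes the drawdown process with initial drawdown $z$ under the constant strategy $B_t=b$.
   Context: Setting. On a complete probability space $(\Omega,\mathcal F,\mathbb P)$ let $W$ be a standard Brownian motion and $N=\{N_t\}_{t\ge0}$ an ordinary renewal process independent of $W$, with arrival times $0=T_0<T_1<T_2<\cdots$, whose i.i.d. strictly positive interarrival times $T_{k+1}-T_k$ have an arbitrary common distribution. $\{\mathcal F_t\}_{t\ge 0}$ is the smallest right-continuous filtration to which $W$ and $N$ are adapted. Fix real constants $\eta<\theta$, $\sigma>0$, a critical level $d>0$ and a discount rate $r>0$. For $b\in[0,1]$ put $\mu(b)=\eta-(1-b)\theta$ and $\sigma(b)=\sigma b$. Strategies. $\mathcal B$ is the set of all processes $B_t=\sum_{k=0}^\infty b_k\mathbf 1_{[T_k,T_{k+1})}(t)=b_{N_t}$, where each $b_k$ is an $\mathcal F_{T_k}$-measurable random variable with values in $[0,1]$. Drawdown. For $B\in\mathcal B$ let $X_0^B(t)=\int_0^t\mu(B_s)\,ds+\int_0^t\sigma(B_s)\,dW_s$. For $z\ge0$ the drawdown process with initial drawdown $z$ is $\Delta_z^B(t)=\max\{z,\sup_{0\le s\le t}X_0^B(s)\}-X_0^B(t)$.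 For constant $b\in[0,1]$, $\Delta_z^b$ denotes $\Delta_z^B$ with $B_t=b$ for all $t$. In an expression such as $\Delta_z^{b^*(z)}$ the number $b^*(z)$ is used as a constant strategy. Value function. $v^B(z)=\mathbb E\bigl[\sum_{k=0}^\infty e^{-rT_k}\mathbf 1_{\{\Delta_z^B(T_k)>d\}}\bigr]$ and $v(z)=\inf_{B\in\mathcal B}v^B(z)$ for $z\ge0$. *)

(* Defs.v *)
From HB Require Import structures.
From mathcomp Require Import all_boot all_order all_algebra.
From mathcomp Require Import finmap.
From mathcomp Require Import all_classical all_reals all_analysis.

Set Implicit Arguments.
Unset Strict Implicit.
Unset Printing Implicit Defensive.

Import Order.TTheory GRing.Theory Num.Theory.
Import numFieldNormedType.Exports.

Local Open Scope classical_set_scope.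
Local Open Scope ring_scope.

(* Processes are functions of time (a real number, only times t >= 0 being
   relevant) and of the sample point. *)

Section independence.
Context {d : measure_display} {Omega : measurableType d} {R : realType}.
Implicit Type P : probability Omega R.

Definition indep_systems P (G H : set (set Omega)) : Prop :=
  forall A B, G A -> H B -> P (A `&` B) = (P A * P B)%E.

Definition mutually_indep P (Y : nat -> Omega -> R) : Prop :=
  forall (J : {fset nat}) (A : nat -> set R), (forall j, measurable (A j)) ->
    P (\bigcap_(j in [set` J]) (Y j @^-1` A j))
    = (\prod_(j <- J) P (Y j @^-1` A j))%E.

Definition identically_distributed P (Y : nat -> Omega -> R) : Prop :=
  forall j (A : set R), measurable A -> P (Y j @^-1` A) = P (Y 0%N @^-1` A).

(* sigma-algebra generated by the X_t, t in D *)
Definition sigma_process {d'} {U : measurableType d'}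
    (X : R -> Omega -> U) (D : set R) : set (set Omega) :=
  <<s \bigcup_(t in D) preimage_set_system setT (X t) measurable >>.

End independence.

Section processes.
Context {d : measure_display} {Omega : measurableType d} {R : realType}.
Implicit Types (P : probability Omega R) (W : R -> Omega -> R).

Record standard_brownian_motion P W : Prop := {
  bm_measurable : forall t, 0 <= t -> measurable_fun setT (W t) ;
  bm_start : forall w, W 0 w = 0 ;
  bm_continuous : forall w, {within `[0, +oo[, continuous (W ^~ w)} ;
  bm_gaussian : forall s t, 0 <= s < t -> forall A : set R, measurable A ->
    P ((fun w => W t w - W s w) @^-1` A)
    = normal_prob 0 (Num.sqrt (t - s)) A ;
  bm_indep_increments : forall s t, 0 <= s < t ->
    indep_systems P (sigma_process W `[0, s])
      (preimage_set_system setT (fun w => W t w - W s w) measurable)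
}.

(* N is the counting process of the arrival times 0 = T_0 < T_1 < ... *)
Record renewal_process P (N : R -> Omega -> nat) (T : nat -> Omega -> R) :
    Prop := {
  rp_measurable : forall k, measurable_fun setT (T k) ;
  rp_start : forall w, T 0%N w = 0 ;
  rp_increasing : forall k w, T k w < T k.+1 w ;
  rp_count : forall t w k, 0 <= t -> (k <= N t w)%N = (T k w <= t) ;
  rp_indep : mutually_indep P (fun k w => T k.+1 w - T k w) ;
  rp_ident : identically_distributed P (fun k w => T k.+1 w - T k w)
}.

Variables (W : R -> Omega -> R) (N : R -> Omega -> nat).

Definition natural_filtration (t : R) : set (set Omega) :=
  <<s sigma_process W `[0, t] `|` sigma_process N `[0, t] >>.

Definition filtration (t : R) : set (set Omega) :=
  \bigcap_(s in `]t, +oo[) natural_filtration s.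

Definition right_continuous_filtration (G : R -> set (set Omega)) : Prop :=
  forall t, 0 <= t ->
    sigma_algebra setT (G t) /\ G t = \bigcap_(s in `]t, +oo[) G s.

Definition adapted {d'} {U : measurableType d'}
    (G : R -> set (set Omega)) (X : R -> Omega -> U) : Prop :=
  forall t, 0 <= t -> preimage_set_system setT (X t) measurable `<=` G t.

Lemma natural_filtration_mono s t : s <= t ->
  natural_filtration s `<=` natural_filtration t.
Proof.
have le_process d' (U : measurableType d') (X : R -> Omega -> U) : s <= t ->
    sigma_process X `[0, s] `<=` sigma_process X `[0, t].
  move=> st; apply: sub_sigma_algebra2 => A [u /=].
  rewrite in_itv/= => /andP[u0 us] XA; exists u => //=.
  by rewrite in_itv/= u0 (le_trans us st).
by move=> st; apply: sub_sigma_algebra2; apply: setUSS; exact: le_process.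
Qed.

Lemma filtration_right_continuous : right_continuous_filtration filtration.
Proof.
move=> t t0; split.
  by apply: sigma_algebra_bigcap => s _; exact: smallest_sigma_algebra.
apply/seteqP; split=> A.
  move=> FA s /=; rewrite in_itv/= andbT => ts u /=.
  rewrite in_itv/= andbT => su.
  by apply: FA; rewrite /= in_itv/= andbT (lt_trans ts su).
move=> FA s /=; rewrite in_itv/= andbT => ts.
apply: (FA ((t + s) / 2)) => /=; rewrite in_itv/= andbT.
- by rewrite midf_lt.
- by rewrite midf_lt.
Qed.

Lemma filtration_adaptedW : adapted filtration W.
Proof.
move=> t t0 A XA s /=; rewrite in_itv/= andbT => ts.
apply: sub_gen_smallest; left; apply: sub_gen_smallest; exists t => //=.
by rewrite in_itv/= t0 ltW.
Qed.

Lemma filtration_adaptedN : adapted filtration N.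
Proof.
move=> t t0 A XA s /=; rewrite in_itv/= andbT => ts.
apply: sub_gen_smallest; right; apply: sub_gen_smallest; exists t => //=.
by rewrite in_itv/= t0 ltW.
Qed.

Lemma filtration_smallest (G : R -> set (set Omega)) :
  right_continuous_filtration G -> adapted G W -> adapted G N ->
  forall t, 0 <= t -> filtration t `<=` G t.
Proof.
move=> rG GW GN t t0; have [_ ->] := rG _ t0 => A FA s ts.
have s0 : 0 <= s.
  by move: ts => /=; rewrite in_itv/= andbT => /ltW; exact: le_trans.
have sG : sigma_algebra setT (G s) by have [] := rG _ s0.
have mono u : 0 <= u <= s -> G u `<=` G s.
  move=> /andP[u0]; rewrite le_eqVlt => /predU1P[->//|us] B.
  by have [_ ->] := rG _ u0; apply; rewrite /= in_itv/= us.
have gen d' (U : measurableType d') (X : R -> Omega -> U) :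
    adapted G X -> sigma_process X `[0, s] `<=` G s.
  move=> GX; apply: smallest_sub => // B [u /=].
  rewrite in_itv/= => us XB; apply: (mono u us); apply: GX XB.
  by case/andP: us.
apply: (_ : natural_filtration s `<=` G s); last exact: FA.
apply: smallest_sub => // B [|]; exact: gen.
Qed.

(* the sigma-algebra of events prior to the stopping time tau *)
Definition stopped_sigma_algebra (tau : Omega -> R) : set (set Omega) :=
  [set A | measurable A /\
    forall t, 0 <= t -> filtration t (A `&` [set w | tau w <= t])].

Variable T : nat -> Omega -> R.

Definition admissible_controls : set (nat -> Omega -> R) :=
  [set b : nat -> Omega -> R | (forall k w, 0 <= b k w <= 1) /\
    forall k, preimage_set_system setT (b k) measurable
              `<=` stopped_sigma_algebra (T k)].

Definition strategies : set (R -> Omega -> R) :=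
  [set (fun t w => b (N t w) w) | b in admissible_controls].

(* Ito integral over [0, t] of an integrand H that is constant on each
   [T_k, T_k+1[ (all integrands below are of this kind) *)
Definition stochastic_integral (H : R -> Omega -> R) (t : R) (w : Omega) : R :=
  \sum_(k < (N t w).+1)
    H (T k w) w * (W (Num.min t (T k.+1 w)) w - W (T k w) w).

Variables eta theta sigma : R.

Definition drift (b : R) : R := eta - (1 - b) * theta.
Definition volatility (b : R) : R := sigma * b.

Definition surplus (B : R -> Omega -> R) (t : R) (w : Omega) : R :=
  \int[lebesgue_measure]_(s in `[0, t]) drift (B s w)
  + stochastic_integral (fun s w => volatility (B s w)) t w.

Definition drawdown (B : R -> Omega -> R) (z t : R) (w : Omega) : R :=
  Num.max z (sup [set surplus B s w | s in `[0, t]]) - surplus B t w.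

Variables (P : probability Omega R) (crit r : R).

Definition strategy_value (B : R -> Omega -> R) (z : R) : \bar R :=
  (\int[P]_w \sum_(0 <= k <oo)
     (expR (- r * T k w)
      * \1_[set w' | crit < drawdown B z (T k w') w'] w)%:E)%E.

Definition value (z : R) : \bar R :=
  ereal_inf [set strategy_value B z | B in strategies].

(* E[exp(-r T_1) v(Delta_z^b(T_1))] for the constant strategy b *)
Definition continuation_value (z b : R) : \bar R :=
  (\int[P]_w ((expR (- r * T 1%N w))%:E
              * value (drawdown (fun _ _ => b) z (T 1%N w) w)))%E.

End processes.

(* Main.v *)
Require Import Defs.
From HB Require Import structures.
From mathcomp Require Import all_boot all_order all_algebra.
From mathcomp Require Import finmap.
From mathcomp Require Import all_classical all_reals all_analysis.
From mathcomp Require Import measurable_realfun ring lra.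

Set Implicit Arguments.
Unset Strict Implicit.
Unset Printing Implicit Defensive.

Import Order.TTheory GRing.Theory Num.Theory.
Import numFieldNormedType.Exports.

Local Open Scope classical_set_scope.
Local Open Scope ring_scope.

(* The drawdown is sampled at the arrival times, where it is a controlled
   Markov chain: Delta_(k+1) is a function of Delta_k, b_k and of the pair
   (interarrival time, Brownian path restarted at T_k). This pair is
   independent of F_(T_k) and has a fixed law; because of the right limit in
   the definition of the filtration, this is proved by rounding T_k up to a
   grid of mesh e and letting e tend to 0. In the resulting Markov decision
   problem the iterates of the Bellman operator, starting from 0, increase to
   a limit u that is lower semicontinuous; by compactness of [0, 1] the
   infimum over controls commutes with this limit, so u solves the Bellman
   equation, and the least minimiser of the continuation value of u is a
   measurable function of the state. Any strategy costs at least every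
   iterate, and the Markov strategy given by the minimiser costs at most u, so
   u is the value function. *)

(** * Independence and uniqueness of measures *)

(** Defined as an infimum over strategies, the value function is not visibly measurable in the
    state; this comes from its identity with [u]. The running cost is the indicator of an open
    half-line, hence lower semicontinuous but discontinuous. Lower semicontinuity is therefore the
    regularity carried along: Fatou's lemma takes it through the expectation, compactness through
    the minimum. All quantities are nonnegative extended reals, so Tonelli and monotone convergence
    apply directly. The obstacle in the independence claim is that N is in general not Markov: the
    time elapsed since the last arrival is informative about the next one. Only on the event that a
    fixed time s lies in [T_k, T_(k+1)) does the past reduce to W up to s and the first k
    interarrival times, which are independent of the next one. A grid time above T_k satisfies this
    only if the next arrival is not too close, so interarrival times are first cut off at 2 * e;
    their strict positivity removes the cut-off in the limit. *)

Section measure_uniqueness.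
Context {d : measure_display} {T : measurableType d} {R : realType}.
Local Open Scope ereal_scope.

(** Adjoining [setT] to the pi-system keeps it closed under intersection and supplies the covering
    sequence of the uniqueness theorem. *)
Lemma pi_measure_unique (m1 m2 : {measure set T -> \bar R}) (G : set (set T)) :
  G `<=` measurable -> setI_closed G -> m1 setT < +oo -> m1 setT = m2 setT ->
  (forall A, G A -> m1 A = m2 A) -> forall A, <<s G >> A -> m1 A = m2 A.
Proof.
move=> mG GI fin mT eqG A sA.
apply: (@g_sigma_algebra_measure_unique _ _ _ (G `|` [set setT]) _
   (fun=> setT)) => //.
- by move=> B [/mG//|->].
- by right.
- by apply/seteqP; split => // x _; exists 0%N.
- move=> B C [GB|->] [GC|->].
  + by left; exact: GI.
  + by rewrite setIT; left.
  + by rewrite setTI; left.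
  + by rewrite setTI; right.
- by move=> B [/eqG//|->].
- by apply: sub_sigma_algebra2 sA => B; left.
Qed.

End measure_uniqueness.

Section independence_tools.
Context {d : measure_display} {T : measurableType d} {R : realType}.
Local Open Scope ereal_scope.

(** For fixed [B] both sides are finite measures in [A] of equal total mass: [P] restricted to [B],
    and [P] scaled by [P B]. *)
Lemma indep_generated (P : probability T R) (G : set (set T)) (B : set T) :
  G `<=` measurable -> setI_closed G -> measurable B ->
  (forall A, G A -> P (A `&` B) = P A * P B) ->
  forall A, <<s G >> A -> P (A `&` B) = P A * P B.
Proof.
move=> mG GI mB GB A sA.
have PB : P B \is a fin_num by exact: fin_num_measure.
have PB0 : (0 <= fine (P B))%R by exact: fine_ge0.
have sE C : mscale (NngNum PB0) P C = P C * P B.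
  by rewrite /mscale/= fineK// muleC.
rewrite -sE; apply: (@pi_measure_unique _ _ _ (mrestr P mB) _ G) => //.
- by rewrite /= /mrestr setTI ltey_eq PB.
- by rewrite [RHS]sE /= /mrestr setTI probability_setT mul1e.
- by move=> C /GB E; rewrite [RHS]sE -E.
Qed.

(** Here the event is fixed and the measures live on the target space. [X0] carries the expected law
    of [X], so that independence and equality in law are obtained together. *)
Lemma indep_law {d'} {E : measurableType d'} (P : probability T R)
    (G : set (set E)) (A : set T) (X X0 : T -> E) :
  measurable = <<s G >> -> setI_closed G -> measurable A ->
  measurable_fun setT X -> measurable_fun setT X0 ->
  (forall B, G B -> P (A `&` X @^-1` B) = P A * P (X0 @^-1` B)) ->
  forall B, measurable B -> P (A `&` X @^-1` B) = P A * P (X0 @^-1` B).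
Proof.
move=> GE GI mA mX mX0 GB B; rewrite GE => sB.
have PA : P A \is a fin_num by exact: fin_num_measure.
have PA0 : (0 <= fine (P A))%R by exact: fine_ge0.
pose m1 := pushforward (mrestr P mA) X.
pose m2 := mscale (NngNum PA0) (distribution P (mfun_Sub (mem_set mX0))).
have m1E C : m1 C = P (A `&` X @^-1` C) by rewrite /m1 /pushforward /mrestr setIC.
have m2E C : m2 C = P A * P (X0 @^-1` C).
  by rewrite /m2 /mscale/= /distribution/pushforward/= fineK.
rewrite -m1E -m2E; apply: (@pi_measure_unique _ _ _ (pushforward (mrestr P mA) X) m2 G) => //.
- by rewrite GE; exact: sub_sigma_algebra.
- by rewrite [ltLHS]m1E preimage_setT setIT ltey_eq PA.
- by rewrite [LHS]m1E [RHS]m2E !preimage_setT setIT probability_setT mule1.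
- by move=> C /GB E0; rewrite [LHS]m1E [RHS]m2E.
Qed.

(** Freezing lemma: the joint law of the identity map into the coarser space and of [X] is a
    product, and Tonelli applies. Taking the identity as first coordinate lets [h] depend on every
    [G]-measurable quantity at once. *)
Lemma integral_indep {d'} {E : measurableType d'} (P : probability T R)
    (Q : probability E R) (G : set (set T)) (X : T -> E)
    (h : g_sigma_algebraType G * E -> \bar R) :
  G `<=` measurable -> sigma_algebra setT G -> measurable_fun setT X ->
  (forall A B, G A -> measurable B -> P (A `&` X @^-1` B) = P A * Q B) ->
  measurable_fun [set: g_sigma_algebraType G * E] h -> (forall x, 0 <= h x) ->
  \int[P]_w h (w, X w) = \int[P]_w \int[Q]_e h (w, e).
Proof.
move=> mG sG mX ind mh h0.
have GE : G.-sigma.-measurable = G by exact: measurable_g_measurableTypeE.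
pose i := (fun x : T => x : g_sigma_algebraType G).
have mi : measurable_fun setT i.
  by move=> _ A; rewrite GE => GA; rewrite setTI; exact: mG.
have mi' : measurable_fun setT (fun w => (i w, X w)) by exact: measurable_fun_pair.
rewrite -(@ge0_integral_pushforward _ _ _ _ _ (fun w => (i w, X w)) mi' P setT h)//.
pose m1 := distribution P (mfun_Sub (mem_set mi)).
rewrite (eq_measure_integral (m1 \x Q)); last first.
  move=> A mA _; apply/esym; apply: product_measure_unique => // B C.
  by rewrite GE => GB mC; exact: ind.
rewrite fubini_tonelli1// ge0_integral_distribution//.
  exact: measurable_fun_fubini_tonelli_F.
by move=> x; apply: integral_ge0.
Qed.

End independence_tools.

(** * Continuous processes evaluated at random times *)

Lemma cvg_floor_grid (R : realType) (x : R) :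
  (Num.floor (x * n.+1%:R))%:~R / n.+1%:R @[n --> \oo] --> x.
Proof.
apply/cvgrPdist_lt => e e0.
near=> n.
have n0 : 0 < n.+1%:R :> R by [].
have ne : n.+1%:R^-1 < e by near: n; exact: near_infty_natSinv_lt (PosNum e0).
have /andP[fl fu] := floor_itv (x * n.+1%:R).
apply: le_lt_trans ne.
set f := (Num.floor _)%:~R in fl fu *.
have -> : x - f / n.+1%:R = (x * n.+1%:R - f) / n.+1%:R by field; rewrite gt_eqF.
rewrite normrM normfV (ger0_norm (ltW n0)) ler_pdivrMr// mulVf ?gt_eqF//.
rewrite ger0_norm ?subr_ge0//.
by rewrite lerBlDr addrC; move: fu; rewrite intrD => /ltW.
Unshelve. all: by end_near. Qed.

(** Rounding [g x] down to a grid involves only countably many of the measurable maps [Y ^~ t];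
    continuity in time recovers the limit. *)
Lemma measurable_continuous_process d (T : measurableType d) (R : realType)
    (Y : T -> R -> R) (g : T -> R) :
  (forall x, continuous (Y x)) -> (forall t, measurable_fun setT (Y ^~ t)) ->
  measurable_fun setT g -> measurable_fun setT (fun x => Y x (g x)).
Proof.
move=> cY mY mg.
apply: (measurable_fun_cvg (h := fun n x =>
  Y x ((Num.floor (g x * n.+1%:R))%:~R / n.+1%:R))); last first.
  by move=> x _; apply: continuous_cvg; [exact: cY|exact: cvg_floor_grid].
move=> n _ B mB; rewrite setTI.
rewrite [X in measurable X](_ : _ = \bigcup_(m : int)
  ((fun x => g x * n.+1%:R) @^-1` `[m%:~R, (m + 1)%:~R[%classic `&`
   (Y ^~ (m%:~R / n.+1%:R)) @^-1` B)); last first.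
  apply/seteqP; split => [x /= YB|x [m _ [/= ]]].
    exists (Num.floor (g x * n.+1%:R)) => //; split => //=.
    by rewrite in_itv/= floor_itv.
  rewrite in_itv/= => xm; rewrite (_ : Num.floor _ = m)//.
  exact/floor_def.
apply: countable_bigcupT_measurable => [|m]; first exact: countableP.
apply: measurableI; last first.
  by rewrite -[X in measurable X]setTI; exact: mY.
rewrite -[X in measurable X]setTI.
exact: (measurable_funM mg (measurable_cst _)).
Qed.

(** * Path space *)

Definition cpath (R : realType) := {w : R -> R | continuous w}.

Definition cpath_fun (R : realType) (w : cpath R) : R -> R := sval w.
Coercion cpath_fun : cpath >-> Funclass.

Lemma cpath_continuous (R : realType) (w : cpath R) : continuous w.
Proof. exact: (svalP w). Qed.

Lemma cpath0_subproof (R : realType) : continuous (fun _ : R => (0 : R)).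
Proof. by move=> x; exact: cvg_cst. Qed.

Definition cpath0 (R : realType) : cpath R :=
  exist (fun w : R -> R => continuous w) _ (@cpath0_subproof R).

HB.instance Definition _ (R : realType) := gen_eqMixin (cpath R).
HB.instance Definition _ (R : realType) := gen_choiceMixin (cpath R).
HB.instance Definition _ (R : realType) :=
  isPointed.Build (cpath R) (cpath0 R).

(** Strict lower bounds suffice, since half-lines generate the Borel sets. Concatenation of lists
    gives intersections, hence a pi-system; strictness lets continuous ramps converge to the
    indicator. *)
Definition cylinder (R : realType) (L : seq (R * R)) : set (cpath R) :=
  [set w | forall p, p \in L -> p.2 < w p.1].

Notation cpathType R := (g_sigma_algebraType (range (@cylinder R))).

Lemma cylinder_setI (R : realType) : setI_closed (range (@cylinder R)).
Proof.
move=> _ _ [L _ <-] [K _ <-]; exists (L ++ K) => //.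
apply/seteqP; split => [w LK|w [Lw Kw] p].
  by split => p pL; apply: LK; rewrite mem_cat pL ?orbT.
by rewrite mem_cat => /orP[/Lw|/Kw].
Qed.

Lemma measurable_cpath_eval (R : realType) (t : R) :
  measurable_fun [set: cpathType R] (fun w : cpathType R => (w : cpath R) t).
Proof.
apply: (measurability _ (RGenOInfty.measurableE R)) => _ [_ [c ->] <-].
apply: sub_sigma_algebra; exists [:: (t, c)] => //; rewrite setTI.
apply/seteqP; split => [w /(_ _ (mem_head _ _))|w /= cw p].
  by rewrite /= in_itv/= andbT.
by rewrite inE => /eqP ->; move: cw; rewrite in_itv/= andbT.
Qed.

Lemma measurable_cpath_valued (R : realType) d (T : measurableType d)
    (f : T -> cpathType R) :
  (forall t, measurable_fun setT (fun x => (f x : cpath R) t)) ->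
  measurable_fun setT f.
Proof.
move=> mf; apply: (@measurability _ _ T (cpathType R) setT f (range (@cylinder R))) =>
  // _ [_ [L _ <-] <-].
rewrite setTI; elim: L => [|p L IH].
  by rewrite [X in measurable X](_ : _ = setT)//; apply/seteqP.
rewrite [X in measurable X](_ : _ =
  (fun x => (f x : cpath R) p.1) @^-1` `]p.2, +oo[%classic `&` (f @^-1` cylinder L)).
  by apply: measurableI => //; rewrite -[X in measurable X]setTI; exact: mf.
apply/seteqP; split => [x /= H|x [/= + H] q].
  split => [|q qL]; last by apply: H; rewrite inE qL orbT.
  by rewrite in_itv/= andbT; apply: H; rewrite mem_head.
by rewrite in_itv/= andbT inE => px /predU1P[->//|/H].
Qed.

(** * Independence and stationarity of Brownian increments *)

(* [normal_prob m 0] is not the Dirac mass at m but the junk uniform law on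
   [0, 1]. *)
Definition shift_kernel (R : realType) (v : R) (g : R -> \bar R)
    : R -> \bar R :=
  if v == 0 then g
  else fun x => (\int[normal_prob 0 (Num.sqrt v)]_y g (x + y)%R)%E.

Lemma shift_kernel_ge0 (R : realType) (v : R) (g : R -> \bar R) :
  (forall x, 0 <= g x)%E -> forall x, (0 <= shift_kernel v g x)%E.
Proof.
by move=> g0 x; rewrite /shift_kernel; case: ifP => // _; exact: integral_ge0.
Qed.

Lemma measurable_shift_kernel (R : realType) (v : R) (g : R -> \bar R) :
  (forall x, 0 <= g x)%E -> measurable_fun setT g ->
  measurable_fun setT (shift_kernel v g).
Proof.
move=> g0 mg; rewrite /shift_kernel; case: ifP => // _.
have mh : measurable_fun setT (fun p : R * R => g (p.1 + p.2)).
  apply: measurableT_comp mg _.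
  by apply: measurable_funD; [exact: measurable_fst|exact: measurable_snd].
exact: (@measurable_fun_fubini_tonelli_F _ _ _ _ R (normal_prob 0 (Num.sqrt v))
  _ mh (fun x => g0 _)).
Qed.

Section sigma_process_theory.
Context d d' (Omega : measurableType d) (U : measurableType d') (R : realType).
Variable X : R -> Omega -> U.

Lemma sigma_process_sigma_algebra D : sigma_algebra setT (sigma_process X D).
Proof. exact: smallest_sigma_algebra. Qed.

Lemma sigma_processE D : (sigma_process X D).-sigma.-measurable = sigma_process X D.
Proof. by apply: measurable_g_measurableTypeE; exact: sigma_process_sigma_algebra. Qed.

Lemma sigma_process_measurable D :
  (forall t, D t -> measurable_fun setT (X t)) ->
  sigma_process X D `<=` measurable.
Proof.
move=> mX; apply: smallest_sub; first exact: sigma_algebra_measurable.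
by move=> A [t Dt] [B mB <-]; exact: mX.
Qed.

Lemma sigma_processS D D' : D `<=` D' -> sigma_process X D `<=` sigma_process X D'.
Proof.
by move=> DD'; apply: sub_sigma_algebra2 => A [t /DD' Dt XA]; exists t.
Qed.

Lemma measurable_sigma_process D t : D t ->
  measurable_fun [set: g_sigma_algebraType (sigma_process X D)] (X t).
Proof.
move=> Dt _ B mB; rewrite sigma_processE; apply: sub_sigma_algebra.
by exists t => //; exists B.
Qed.

End sigma_process_theory.

Section brownian_increments.
Context d (Omega : measurableType d) (R : realType) (P : probability Omega R).
Variable W : R -> Omega -> R.
Hypothesis hW : standard_brownian_motion P W.

(** Markov property of one increment: it is independent of the past up to [u], so it is integrated
    out against its normal law. For u = t the kernel is the identity. *)
Lemma brownian_integral_step (u t : R) (F : Omega -> \bar R) (X : Omega -> R)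
    (g : R -> \bar R) : 0 <= u <= t ->
  measurable_fun [set: g_sigma_algebraType (sigma_process W `[0, u])] F ->
  measurable_fun [set: g_sigma_algebraType (sigma_process W `[0, u])] X ->
  measurable_fun setT g -> (forall w, 0 <= F w)%E -> (forall x, 0 <= g x)%E ->
  (\int[P]_w (F w * g (X w + (W t w - W u w))%R) =
   \int[P]_w (F w * shift_kernel (t - u) g (X w)))%E.
Proof.
move=> /andP[u0]; rewrite le_eqVlt => /predU1P[<-|ut] mF mX mg F0 g0.
  by apply: eq_integral => w _; rewrite /shift_kernel !subrr addr0 eqxx.
rewrite /shift_kernel subr_eq0 gt_eqF//.
pose D w := W t w - W u w.
have mW s : 0 <= s -> measurable_fun setT (W s) by exact: (bm_measurable hW).
have mD : measurable_fun setT D.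
  by apply: measurable_funB; apply: mW => //; exact: le_trans (ltW ut).
pose h (p : g_sigma_algebraType (sigma_process W `[0, u]) * R) : \bar R :=
  (F p.1 * g (X p.1 + p.2)%R)%E.
transitivity (\int[P]_w h (w, D w))%E; first by [].
rewrite (@integral_indep _ _ _ _ _ P (normal_prob 0 (Num.sqrt (t - u)))).
- apply: eq_integral => w _; rewrite /h/= ge0_integralZl//.
  apply: measurableT_comp mg _.
  by apply: measurable_funD => //; exact: measurable_cst.
- apply: sigma_process_measurable => s /=; rewrite in_itv/= => /andP[s0 _].
  exact: mW.
- exact: sigma_process_sigma_algebra.
- exact: mD.
- move=> A B sA mB.
  have u0t : 0 <= u < t by rewrite u0.
  apply: etrans (congr1 (mule (P A)) (bm_gaussian hW u0t mB)).
  apply: (bm_indep_increments hW u0t) => //.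
  by exists B => //; rewrite setTI.
- apply: emeasurable_funM.
    by apply: measurableT_comp mF _; exact: measurable_fst.
  apply: measurableT_comp mg _; apply: measurable_funD; last exact: measurable_snd.
  by apply: measurableT_comp mX _; exact: measurable_fst.
- by move=> x; rewrite mule_ge0.
Qed.

(** For nonnegative times in [L] this is the event that the path restarted at [s] lies in
    [cylinder L]. *)
Definition exceed (s : R) (L : seq (R * R)) : set Omega :=
  [set w | forall p, p \in L -> p.2 < W (s + p.1) w - W s w].

Lemma exceed_rcons s L p : exceed s (rcons L p) =
  exceed s L `&` (fun w => W (s + p.1) w - W s w) @^-1` `]p.2, +oo[%classic.
Proof.
apply/seteqP; split => [w H|w [H /=] + q].
  split; first by move=> q qL; apply: H; rewrite mem_rcons inE qL orbT.
  by rewrite /= in_itv/= andbT; apply: H; rewrite mem_rcons mem_head.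
by rewrite in_itv/= andbT mem_rcons inE => pw /predU1P[->//|/H].
Qed.

Lemma exceed_past s L : 0 <= s -> path <=%R 0 (map fst L) ->
  0 <= last 0 (map fst L) /\
  sigma_process W `[0, s + last 0 (map fst L)] (exceed s L).
Proof.
move=> s0; elim/last_ind: L => [_|L p IH].
  split => //=; have [+ sC _] := sigma_process_sigma_algebra W `[0, s + 0].
  move=> /sC; rewrite setD0 (_ : exceed s [::] = setT)//.
  by apply/seteqP; split.
rewrite map_rcons rcons_path last_rcons => /andP[/IH[l0 mL] lp].
have p0 : 0 <= p.1 by exact: le_trans lp.
split=> //; rewrite exceed_rcons -sigma_processE; apply: measurableI.
  rewrite sigma_processE; apply: sigma_processS mL => t /=.
  by rewrite !in_itv/= => /andP[-> /= /le_trans]; apply; rewrite lerD2l.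
rewrite -[X in measurable X]setTI; apply: measurable_funB => //.
- by apply: measurable_sigma_process => /=; rewrite in_itv/= addr_ge0/=.
- by apply: measurable_sigma_process => /=; rewrite in_itv/= s0 lerDl.
Qed.

(** The test function [g] of the last increment is what the induction needs: peeling off the largest
    time replaces [g] by the kernel applied to [g] cut off to the last half-line. This new function
    does not depend on [s], so the same reduction serves for the starts [s] and 0, and at the empty
    list only the factor [P A] distinguishes them. *)
Lemma brownian_cylinder s A L (g : R -> \bar R) :
  0 <= s -> path <=%R 0 (map fst L) -> sigma_process W `[0, s] A ->
  measurable_fun setT g -> (forall x, 0 <= g x)%E ->
  (\int[P]_w ((\1_(A `&` exceed s L) w)%:E *
     g (W (s + last 0 (map fst L)) w - W s w)%R) =
   P A * \int[P]_w ((\1_(exceed 0 L) w)%:E *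
     g (W (0 + last 0 (map fst L)) w - W 0 w)%R))%E.
Proof.
move=> s0 + sA; have mA : measurable A.
  apply: sigma_process_measurable sA => t /=; rewrite in_itv/= => /andP[t0 _].
  exact: (bm_measurable hW t0).
have mI (v : R) (B : set Omega) (sB : sigma_process W `[0, v] B) :
    measurable_fun [set: g_sigma_algebraType (sigma_process W `[0, v])]
      (fun w => (\1_B w)%:E : \bar R).
  apply/measurable_EFinP; apply: measurable_indic.
  by rewrite -sigma_processE in sB.
elim/last_ind: L g => [|L p IH] g.
  move=> _ mg g0 /=; rewrite !addr0.
  have base u B : measurable B -> (\int[P]_w ((\1_(B `&` exceed u [::]) w)%:E *
      g (W u w - W u w)%R) = P B * g 0%R)%E.
    move=> mB; under eq_integral do rewrite subrr.
    rewrite (_ : exceed u [::] = setT) ?setIT; last by apply/seteqP; split.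
    rewrite ge0_integralZr// ?integral_indic// ?setIT//.
    exact/measurable_EFinP/measurable_indic.
  by rewrite base// -[in RHS](setTI (exceed _ _)) base// probability_setT mul1e.
rewrite map_rcons rcons_path last_rcons => /andP[sL lp] mg g0.
set l := last 0 _ in lp.
pose g' x := ((\1_(`]p.2, +oo[%classic) x)%:E * g x)%E.
have mg' : measurable_fun setT g'.
  apply: emeasurable_funM => //; apply/measurable_EFinP.
  exact: measurable_indic.
have g'0 x : (0 <= g' x)%E by rewrite mule_ge0// lee_fin.
have key u B : 0 <= u -> sigma_process W `[0, u] B ->
  (\int[P]_w ((\1_(B `&` exceed u (rcons L p)) w)%:E *
     g (W (u + p.1) w - W u w)%R) =
   \int[P]_w ((\1_(B `&` exceed u L) w)%:E *
     shift_kernel (p.1 - l) g' (W (u + l) w - W u w)%R))%E.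
  move=> u0 sB; have [l0 mL] := exceed_past u0 sL.
  have ul : 0 <= u + l <= u + p.1 by rewrite addr_ge0//= lerD2l.
  have uE : u + p.1 - (u + l) = p.1 - l by ring.
  rewrite -[in RHS]uE -brownian_integral_step//.
  - apply: eq_integral => w _; rewrite exceed_rcons /g' setIA.
    rewrite (_ : W (u + l) w - W u w + _ = W (u + p.1) w - W u w); last by ring.
    rewrite muleA -EFinM; congr (_%:E * _)%E.
    by rewrite indicI/= !indicE.
  - apply: mI; rewrite -sigma_processE; apply: measurableI; rewrite sigma_processE//.
    apply: sigma_processS sB => t /=; rewrite !in_itv/= => /andP[-> /= /le_trans].
    by apply; rewrite lerDl.
  - apply: measurable_funB; apply: measurable_sigma_process => /=; rewrite in_itv/=.
      by rewrite lexx addr_ge0.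
    by rewrite u0 lerDl.
rewrite key// -[in RHS](setTI (exceed _ _)) [in RHS]key//; last first.
  by rewrite -sigma_processE; exact: measurableT.
rewrite setTI -IH//; first exact: measurable_shift_kernel.
exact: shift_kernel_ge0.
Qed.

End brownian_increments.

(** * Brownian path restarted at a fixed time *)

Definition mk_cpath (R : realType) (f : R -> R) : cpath R :=
  if pselect (continuous f) is left cf
  then exist (fun w : R -> R => continuous w) f cf else cpath0 R.

Lemma mk_cpathE (R : realType) (f : R -> R) : continuous f ->
  mk_cpath f = f :> (R -> R).
Proof. by rewrite /mk_cpath => cf; case: pselect. Qed.

(** Brownian paths are continuous only within the half-line of nonnegative times; composing with a
    map into it gives continuity on the whole line. *)
Lemma continuous_comp_within (R : realType) (f g : R -> R) (D : set R) :
  {within D, continuous f} -> continuous g -> (forall x, D (g x)) ->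
  continuous (f \o g).
Proof.
move=> /subspace_continuousP cf cg gD x.
apply: (@cvg_comp _ _ _ g f _ (within D (nbhs (g x)))); last exact: cf.
move=> U DU; have H : \forall y \near x, D (g y) -> U (g y) := cg x _ DU.
change (\forall y \near x, U (g y)).
by near=> y; apply: (near H y _) => //; exact: gD.
Unshelve. all: by end_near.
Qed.

Section shifted_path.
Context d (Omega : measurableType d) (R : realType).
Variable W : R -> Omega -> R.
Hypothesis cW : forall w, {within `[0, +oo[, continuous (W ^~ w)}.

(** The absolute value extends the path evenly to negative times, making it an element of
    [cpath]. *)
Definition shifted_path (s : R) (w : Omega) : g_sigma_algebraType (range (@cylinder R)) :=
  mk_cpath (fun t => W (s + `|t|) w - W s w).

Lemma shifted_process_continuous (s : R) w : 0 <= s ->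
  continuous (fun t : R => W (s + `|t|) w - W s w).
Proof.
move=> s0.
have cg : continuous (fun t : R => s + `|t|).
  by move=> t; apply: cvgD; [exact: cvg_cst|exact: norm_continuous].
have cc : continuous ((W ^~ w) \o (fun t : R => s + `|t|)).
  apply: (@continuous_comp_within R (W ^~ w) _ _ (@cW w) cg).
  by move=> x; rewrite /= in_itv/= andbT addr_ge0.
by move=> t; apply: cvgB; [exact: cc|exact: cvg_cst].
Qed.

Lemma shifted_pathE (s : R) w : 0 <= s ->
  (shifted_path s w : cpath R) = (fun t => W (s + `|t|) w - W s w) :> (R -> R).
Proof. by move=> s0; rewrite mk_cpathE//; exact: shifted_process_continuous. Qed.

Hypothesis mW : forall t, 0 <= t -> measurable_fun setT (W t).

Lemma measurable_shifted_path (s : R) : 0 <= s -> measurable_fun setT (shifted_path s).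
Proof.
move=> s0; apply: measurable_cpath_valued => t.
under eq_fun do rewrite shifted_pathE//.
by apply: measurable_funB; apply: mW => //; rewrite addr_ge0.
Qed.

End shifted_path.

Section brownian_path_law.
Context d (Omega : measurableType d) (R : realType) (P : probability Omega R).
Variable W : R -> Omega -> R.
Hypothesis hW : standard_brownian_motion P W.

Lemma shifted_path_indep s A : 0 <= s -> sigma_process W `[0, s] A ->
  forall B, measurable B ->
  P (A `&` shifted_path W s @^-1` B) = (P A * P (shifted_path W 0 @^-1` B))%E.
Proof.
move=> s0 sA; have cW := bm_continuous hW.
have mW : forall t, 0 <= t -> measurable_fun setT (W t) by exact: (bm_measurable hW).
have mA : measurable A.
  apply: sigma_process_measurable sA => t /=; rewrite in_itv/= => /andP[t0 _].
  exact: mW.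
apply: (@indep_law _ _ _ _ (cpathType R) P (range (@cylinder R)) A
  (shifted_path W s) (shifted_path W 0)) => //.
- exact: cylinder_setI.
- exact: measurable_shifted_path.
- exact: measurable_shifted_path.
move=> _ [L _ <-].
(* The times of a cylinder may be negative and unsorted, while [brownian_cylinder] requires sorted
   nonnegative ones. The path being even, absolute values are taken and sorted. *)
pose K := [seq (`|p.1|, p.2) | p <- L] : seq (R * R).
pose S := sort (fun p q : R * R => p.1 <= q.1) K.
have sS : path <=%R 0 (map fst S).
  rewrite path_min_sorted ?sorted_map; last first.
    apply/allP => x /mapP[p]; rewrite mem_sort => /mapP[q _ ->] ->/=.
    exact: normr_ge0.
  by apply: sort_sorted => p q; exact: le_total.
have cE u : 0 <= u -> shifted_path W u @^-1` cylinder L = exceed W u S.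
  move=> u0; apply/seteqP; split => w /= H p.
    rewrite mem_sort => /mapP[q /H + ->].
    by rewrite shifted_pathE.
  move=> pL; rewrite shifted_pathE//; apply: (H (`|p.1|, p.2)).
  by rewrite mem_sort; apply/mapP; exists p.
have mE u : 0 <= u -> measurable (exceed W u S).
  move=> u0; rewrite -cE// -[X in measurable X]setTI.
  apply: measurable_shifted_path => //; apply: sub_sigma_algebra.
  by exists L.
have := @brownian_cylinder _ _ _ _ _ hW s A S (fun=> 1%E) s0 sS sA
  (measurable_cst _) (fun=> lee01).
under eq_integral do rewrite mule1.
under [in RHS]eq_integral do rewrite mule1.
rewrite !integral_indic ?setIT//; [|exact: mE|by apply: measurableI => //; exact: mE].
by rewrite !cE.
Qed.

End brownian_path_law.

(** * Renewal process *)

Section renewal_theory.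
Context d (Omega : measurableType d) (R : realType) (P : probability Omega R).
Variables (N : R -> Omega -> nat) (T : nat -> Omega -> R).
Hypothesis hN : renewal_process P N T.

Definition interarrival (k : nat) (w : Omega) : R := T k.+1 w - T k w.

Lemma arrival_ge0 k w : 0 <= T k w.
Proof.
elim: k => [|k]; first by rewrite (rp_start hN).
by move=> /le_trans; apply; rewrite ltW// (rp_increasing hN).
Qed.

Lemma interarrival_gt0 k w : 0 < interarrival k w.
Proof. by rewrite subr_gt0 (rp_increasing hN). Qed.

Lemma arrival_sum k w : T k w = \sum_(0 <= j < k) interarrival j w.
Proof. by rewrite telescope_sumr// (rp_start hN) subr0. Qed.

Lemma arrival_mono j k w : (j <= k)%N -> T j w <= T k w.
Proof.
by move=> jk; apply: (@homo_leq _ (T^~ w) <=%R) jk => // [? ? ?|i];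
  [exact: le_trans|rewrite ltW// (rp_increasing hN)].
Qed.

Lemma measurable_arrival k : measurable_fun setT (T k).
Proof. exact: (rp_measurable hN). Qed.

Lemma measurable_interarrival k : measurable_fun setT (interarrival k).
Proof. by apply: measurable_funB; exact: measurable_arrival. Qed.

Lemma count_arrival k w : N (T k w) w = k.
Proof.
apply/eqP; rewrite eqn_leq (rp_count hN)// ?arrival_ge0// lexx andbT.
by rewrite leqNgt (rp_count hN) ?arrival_ge0// -ltNge (rp_increasing hN).
Qed.

Lemma measurable_count t : 0 <= t -> measurable_fun setT (N t).
Proof.
move=> t0; apply: (measurability _ NGenCInfty.measurableE) => _ [_ [k ->] <-].
rewrite setTI [X in measurable X](_ : _ = T k @^-1` `]-oo, t]%classic).
  by rewrite -[X in measurable X]setTI; exact: measurable_arrival.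
by apply/seteqP; split => w /=; rewrite !in_itv/= andbT leEnat (rp_count hN).
Qed.

(** T_k > x means N_x < k. Hence arrival times are functions of the counting process, which
    transfers to them the independence from [W]. *)
Lemma sigma_count_arrival k :
  measurable_fun [set: g_sigma_algebraType (sigma_process N `[0, +oo[)] (T k).
Proof.
apply: (measurability _ (RGenOInfty.measurableE R)) => _ [_ [x ->] <-].
rewrite setTI; have [x0|x0] := ltP x 0.
  rewrite [X in measurable X](_ : _ = setT)//; apply/seteqP; split => w //= _.
  by rewrite in_itv/= andbT (lt_le_trans x0)// arrival_ge0.
rewrite [X in measurable X](_ : _ = ~` (N x @^-1` [set n | (k <= n)%N])).
  apply: measurableC; rewrite -[X in measurable X]setTI.
  by apply: (@measurable_sigma_process _ _ _ _ _ N) => //=; rewrite in_itv/= x0.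
by apply/seteqP; split => w /=; rewrite in_itv/= andbT (rp_count hN)// ltNge => /negP.
Qed.

Lemma sigma_count_interarrival k :
  measurable_fun [set: g_sigma_algebraType (sigma_process N `[0, +oo[)]
    (interarrival k).
Proof. by apply: measurable_funB; exact: sigma_count_arrival. Qed.

Definition interarrival_box (k : nat) (B : nat -> set R) : set Omega :=
  \bigcap_(j in `I_k) interarrival j @^-1` B j.

Lemma sigma_count_interarrival_box k B : (forall j, measurable (B j)) ->
  sigma_process N `[0, +oo[ (interarrival_box k B).
Proof.
move=> mB; rewrite -sigma_processE; apply: fin_bigcap_measurable => // j _.
by rewrite -[X in measurable X]setTI; exact: sigma_count_interarrival.
Qed.

Lemma interarrival_box_indep k B C : (forall j, measurable (B j)) ->
  measurable C ->
  P (interarrival_box k B `&` interarrival k @^-1` C) =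
  (P (interarrival_box k B) * P (interarrival 0 @^-1` C))%E.
Proof.
move=> mB mC; pose J := [fset j in iota 0 k]%fset.
have JE : [set` J] = `I_k.
  by apply/seteqP; split => j /=; rewrite !inE mem_iota add0n.
(* With [C] in slot [k], one family of sets serves for both index sets: the first k indices, and
   those together with k. *)
pose B' j := if j == k then C else B j.
have mB' j : measurable (B' j) by rewrite /B'; case: ifP.
have B'E : interarrival_box k B = \bigcap_(j in [set` J]) interarrival j @^-1` B' j.
  rewrite JE; apply: eq_bigcapr => j /=.
  by rewrite /B'; case: eqP => // ->; rewrite ltnn.
have B'kE : interarrival_box k B `&` interarrival k @^-1` C =
    \bigcap_(j in [set` (k |` J)%fset]) interarrival j @^-1` B' j.
  rewrite B'E set_fsetU set_fset1 bigcap_setU bigcap_set1 setIC; congr (_ `&` _).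
  by rewrite /B' eqxx.
have hI := rp_indep hN.
rewrite B'kE (hI _ _ mB') big_fsetU1/=; last by rewrite !inE mem_iota add0n ltnn.
rewrite -(hI _ _ mB') -B'E muleC; congr (_ * _)%E.
by rewrite /B' eqxx (rp_ident hN).
Qed.

End renewal_theory.

(** * Past of W at a fixed time and of the first k interarrival times *)

Section joint_past.
Context d (Omega : measurableType d) (R : realType) (P : probability Omega R).
Variables (W : R -> Omega -> R) (N : R -> Omega -> nat) (T : nat -> Omega -> R).
Hypothesis hW : standard_brownian_motion P W.
Hypothesis hN : renewal_process P N T.
Hypothesis hWN : indep_systems P (sigma_process W `[0, +oo[)
                           (sigma_process N `[0, +oo[).

(** A pi-system for the information that replaces the filtration at time [s]. In contrast to the
    latter it says nothing about [interarrival T k], not even that it is still running. *)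
Definition past_box (s : R) (k : nat) : set (set Omega) :=
  [set D | exists A B, [/\ sigma_process W `[0, s] A,
    forall j : nat, measurable (B j) & D = A `&` interarrival_box T k B]].

Lemma measurable_brownian t : 0 <= t -> measurable_fun setT (W t).
Proof. exact: (bm_measurable hW). Qed.

Lemma sigma_brownian_sub s : sigma_process W `[0, s] `<=` sigma_process W `[0, +oo[.
Proof.
by apply: sigma_processS => t /=; rewrite !in_itv/= andbT => /andP[].
Qed.

Lemma sigma_brownian_measurable D : D `<=` [set t : R | 0 <= t] ->
  sigma_process W D `<=` measurable.
Proof. by move=> D0; apply: sigma_process_measurable => t /D0/measurable_brownian. Qed.

Lemma sigma_count_measurable D : D `<=` [set t : R | 0 <= t] ->
  sigma_process N D `<=` measurable.
Proof. by move=> D0; apply: sigma_process_measurable => t /D0/(measurable_count hN). Qed.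

Lemma past_box_measurable s k : past_box s k `<=` measurable.
Proof.
move=> _ [A [B [sA mB ->]]]; apply: measurableI.
  apply: sigma_brownian_measurable sA => t /=.
  by rewrite in_itv/= => /andP[].
have := sigma_count_interarrival_box hN k mB.
by apply: sigma_count_measurable => t /=; rewrite in_itv/= andbT.
Qed.

Lemma past_box_setI s k : setI_closed (past_box s k).
Proof.
move=> _ _ [A [B [sA mB ->]]] [A' [B' [sA' mB' ->]]].
exists (A `&` A'), (fun j => B j `&` B' j); split.
- by rewrite -sigma_processE; apply: measurableI; rewrite sigma_processE.
- by move=> j; exact: measurableI.
- rewrite setIACA; congr (_ `&` _); rewrite /interarrival_box.
  by rewrite -bigcapI; apply: eq_bigcapr => j _; rewrite preimage_setI.
Qed.

Definition joint_past s k : set (set Omega) := <<s past_box s k >>.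

Lemma joint_past_indep s k D C B : 0 <= s -> joint_past s k D ->
  measurable C -> measurable B ->
  P (D `&` (interarrival T k @^-1` C `&` shifted_path W s @^-1` B)) =
  (P D * (P (interarrival T 0 @^-1` C) * P (shifted_path W 0 @^-1` B)))%E.
Proof.
move=> s0 pD mC mB.
have sWE : (sigma_process W `[0, +oo[).-sigma.-measurable = sigma_process W `[0, +oo[.
  exact: sigma_processE.
have sN (B' : nat -> set R) : (forall j, measurable (B' j)) ->
    sigma_process N `[0, +oo[ (interarrival_box T k B' `&` interarrival T k @^-1` C).
  move=> mB'; rewrite -sigma_processE; apply: measurableI.
    by rewrite sigma_processE; exact: (sigma_count_interarrival_box hN).
  by rewrite -[X in measurable X]setTI; exact: (sigma_count_interarrival hN).
have sS : sigma_process W `[0, +oo[ (shifted_path W s @^-1` B).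
  rewrite -sWE -[X in measurable X]setTI.
  have : measurable_fun [set: g_sigma_algebraType (sigma_process W `[0, +oo[)] (shifted_path W s).
    apply: measurable_shifted_path s0 => [w|t t0]; first exact: (bm_continuous hW).
    by apply: measurable_sigma_process; rewrite /= in_itv/= t0.
  by apply.
(* Regrouped as one event of [W] and one of [N], the intersection factors by independence of the
   two; each part then factors by itself. *)
have key A B' : sigma_process W `[0, s] A -> (forall j, measurable (B' j)) ->
  P ((A `&` interarrival_box T k B') `&`
     (interarrival T k @^-1` C `&` shifted_path W s @^-1` B)) =
  (P (A `&` interarrival_box T k B') *
   (P (interarrival T 0 @^-1` C) * P (shifted_path W 0 @^-1` B)))%E.
  move=> sA mB'; have sA' := sigma_brownian_sub sA.
  rewrite [X in _ `&` X]setIC setIACA hWN//; last 2 first.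
  - by rewrite -sigma_processE; apply: measurableI; rewrite sigma_processE.
  - exact: sN.
  rewrite [P (A `&` interarrival_box _ _ _)]hWN//; last first.
    exact: (sigma_count_interarrival_box hN).
  rewrite (shifted_path_indep hW)// (interarrival_box_indep hN)//.
  by rewrite muleACA [X in (_ * X)%E]muleC.
have boxT : interarrival_box T k (fun=> setT) = setT.
  by apply/seteqP; split.
have sT : sigma_process W `[0, s] setT.
  by rewrite -sigma_processE; exact: measurableT.
have PE : P (interarrival T k @^-1` C `&` shifted_path W s @^-1` B) =
  (P (interarrival T 0 @^-1` C) * P (shifted_path W 0 @^-1` B))%E.
  have := key setT (fun=> setT) sT (fun=> measurableT).
  by rewrite boxT !setTI probability_setT mul1e.
rewrite -PE; apply: (@indep_generated _ _ _ P (past_box s k)) => //.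
- exact: past_box_measurable.
- exact: past_box_setI.
- apply: measurableI.
    rewrite -[X in measurable X]setTI.
    exact: (measurable_interarrival hN).
  apply: (sigma_brownian_measurable _ sS) => t /=.
  by rewrite in_itv/= andbT.
- by move=> _ [A [B' [sA mB' ->]]]; rewrite PE key.
Qed.

Lemma joint_past_sigma_algebra s k : sigma_algebra setT (joint_past s k).
Proof. exact: smallest_sigma_algebra. Qed.

Lemma joint_pastE s k : (joint_past s k).-sigma.-measurable = joint_past s k.
Proof. exact: measurable_g_measurableTypeE (joint_past_sigma_algebra s k). Qed.

Lemma joint_past_brownian s k A : sigma_process W `[0, s] A -> joint_past s k A.
Proof.
move=> sA; apply: sub_sigma_algebra; exists A, (fun=> setT); split=> //.
by rewrite (_ : interarrival_box _ _ _ = setT) ?setIT//; apply/seteqP; split.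
Qed.

Lemma joint_past_arrival s k j : (j <= k)%N ->
  measurable_fun [set: g_sigma_algebraType (joint_past s k)] (T j).
Proof.
move=> jk; rewrite (_ : T j = fun w => \sum_(i < j) interarrival T i w); last first.
  by apply/funext => w; rewrite (arrival_sum hN) big_mkord.
have mI (i : 'I_j) :
    measurable_fun [set: g_sigma_algebraType (joint_past s k)] (interarrival T i).
  move=> _ B mB; rewrite setTI joint_pastE; apply: sub_sigma_algebra.
  exists setT, (fun l : nat => if l == i then B else setT); split.
  - by rewrite -sigma_processE; exact: measurableT.
  - by move=> l; case: ifP.
  - rewrite setTI; apply/seteqP; split => [w Bw l _ /=|w /(_ i)/=].
      by case: eqP => // ->.
    by rewrite eqxx; apply; exact: leq_trans (ltn_ord i) jk.
exact: measurable_sum.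
Qed.

(* On [T_k <= s < T_(k.+1)] the paths of N up to time s are determined by
   the first k interarrival times. *)
Lemma natural_filtration_trace s k D : 0 <= s -> natural_filtration W N s D ->
  exists2 D', joint_past s k D' &
    D `&` [set w | T k w <= s < T k.+1 w] = D' `&` [set w | T k w <= s < T k.+1 w].
Proof.
move=> s0; set L := [set w | _]; pose C := [set D | exists2 D', joint_past s k D' &
  D `&` L = D' `&` L].
have [J0 JC JU] := joint_past_sigma_algebra s k.
suff sub : natural_filtration W N s `<=` C by move/sub.
have sC : sigma_algebra setT C.
  split.
  - by exists set0.
  - move=> A [A' /JC JA' E]; exists (setT `\` A') => //.
    rewrite !setTD; apply/seteqP; split => w [nA Lw]; split => // Aw; apply: nA.
      by have [] : (A `&` L) w by rewrite E.
    by have [] : (A' `&` L) w by rewrite -E.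
  - move=> A CA; have /choice[A' A'P] : forall n, exists D',
        joint_past s k D' /\ A n `&` L = D' `&` L.
      by move=> n; have [D' ? ?] := CA n; exists D'.
    exists (\bigcup_n A' n); first by apply: JU => n; have [] := A'P n.
    by rewrite !setI_bigcupl; apply: eq_bigcupr => n _; have [_] := A'P n.
apply: smallest_sub => // A [].
  by move=> sA; exists A => //; exact: joint_past_brownian.
move: A; apply: smallest_sub => // A [u /=]; rewrite in_itv/= => /andP[u0 us] [B _ <-].
rewrite setTI.
(* N u = m means T m <= u < T m.+1. For m = k the upper bound is dropped: it refers to T k.+1, which
   [joint_past] does not know, and it holds on the trace because u <= s < T k.+1. *)
exists (\bigcup_(m in B `&` `I_k.+1) (T m @^-1` `]-oo, u]%classic `&`
   [set w | (m < k)%N -> u < T m.+1 w])).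
  rewrite -joint_pastE; apply: bigcup_measurable => m [_ mk]; apply: measurableI.
    by rewrite -[X in measurable X]setTI; apply: joint_past_arrival.
  have [mk'|mk'] := ltnP m k; last first.
    by rewrite [X in measurable X](_ : _ = setT)//; apply/seteqP; split.
  rewrite [X in measurable X](_ : _ = T m.+1 @^-1` `]u, +oo[%classic).
    by rewrite -[X in measurable X]setTI; apply: joint_past_arrival.
  apply/seteqP; split => w /=; rewrite in_itv/= andbT; first exact.
  by [].
apply/seteqP; split => w.
  move=> [/= Bw /andP[Tk Tk1]]; split; last by rewrite /L /= Tk.
  have Nk : (N u w <= k)%N.
    rewrite leqNgt (rp_count hN)// -ltNge; exact: le_lt_trans Tk1.
  exists (N u w) => //; split => /=; first by rewrite in_itv/= -(rp_count hN).
  by move=> _; rewrite ltNge -(rp_count hN)// ltnn.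
move=> [[m [Bm /= mk] [/= + H]] /andP[Tk Tk1]]; rewrite in_itv/= => Tm.
split; last by rewrite /L /= Tk.
rewrite /= (_ : N u w = m)//; apply/eqP; rewrite eqn_leq (rp_count hN)// Tm andbT.
rewrite leqNgt (rp_count hN)// -ltNge.
move: mk; rewrite ltnS leq_eqVlt => /predU1P[->|/H//].
exact: le_lt_trans Tk1.
Qed.

End joint_past.

Section integral_tools.
Context d (T : measurableType d) (R : realType) (P : probability T R).
Local Open Scope ereal_scope.

(** Apply [integral_indep] to the sigma-algebra generated by the single event [A], with its
    indicator as first factor. *)
Lemma integral_indep_event {d'} {E : measurableType d'} (A : set T)
    (X X0 : T -> E) (h : E -> \bar R) :
  measurable A -> measurable_fun setT X -> measurable_fun setT X0 ->
  (forall B, measurable B -> P (A `&` X @^-1` B) = P A * P (X0 @^-1` B)) ->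
  (forall B, measurable B -> P (X @^-1` B) = P (X0 @^-1` B)) ->
  measurable_fun setT h -> (forall x, 0 <= h x) ->
  \int[P]_(w in A) h (X w) = P A * \int[P]_w h (X0 w).
Proof.
move=> mA mX mX0 indA lawX mh h0.
pose iX0 : {mfun T >-> E} := mfun_Sub (mem_set mX0).
pose Q := distribution P iX0.
pose G := <<s [set A] >>.
have sG : sigma_algebra setT G by exact: smallest_sigma_algebra.
have GE : G.-sigma.-measurable = G by exact: measurable_g_measurableTypeE.
have GA : G A by exact: sub_sigma_algebra.
have mG : G `<=` measurable.
  by apply: smallest_sub; [exact: sigma_algebra_measurable|move=> _ ->].
have ind C B : G C -> measurable B -> P (C `&` X @^-1` B) = P C * Q B.
  move=> GC mB; rewrite (_ : Q B = P (X @^-1` B)); last by rewrite lawX.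
  apply: (@indep_generated _ _ _ P [set A]) => //.
  - by move=> _ ->.
  - by move=> _ _ -> ->; rewrite setIid.
  - by rewrite -[Y in measurable Y]setTI; exact: mX.
  - by move=> _ ->; rewrite lawX// indA.
rewrite integral_mkcond.
transitivity (\int[P]_w ((\1_A w)%:E * h (X w))).
  apply: eq_integral => w _; rewrite patchE indicE.
  by case: ifPn => _; rewrite ?mul1e ?mul0e.
rewrite (@integral_indep _ _ _ _ _ P Q G X
  (fun p => (\1_A p.1)%:E * h p.2))//=; last 2 first.
- apply: emeasurable_funM; last first.
    by apply: measurableT_comp mh _; exact: measurable_snd.
  apply/measurable_EFinP.
  have m1 : measurable_fun [set: g_sigma_algebraType G]
      (\1_A : g_sigma_algebraType G -> R) by apply: measurable_indic; rewrite GE.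
  exact: (measurableT_comp m1 (@measurable_fst _ _ _ _)).
- by move=> x; rewrite mule_ge0// lee_fin.
under eq_integral do rewrite ge0_integralZl//.
rewrite ge0_integralZr//; last 2 first.
- exact/measurable_EFinP/measurable_indic.
- exact: integral_ge0.
by rewrite integral_indic// setIT /Q ge0_integral_distribution.
Qed.

Lemma bounded_convergence (f_ : nat -> T -> R) (f : T -> R) :
  (forall n, measurable_fun setT (f_ n)) -> (forall n x, 0 <= f_ n x <= 1)%R ->
  (forall x, f_ ^~ x @ \oo --> f x) ->
  \int[P]_x (f_ n x)%:E @[n --> \oo] --> \int[P]_x (f x)%:E.
Proof.
move=> mf f01 cf.
have mf0 : measurable_fun setT f.
  by apply: (measurable_fun_cvg (h := f_)) => // x _; exact: cf.
have h1 : {ae P, forall x, setT x -> (f_ n x)%:E @[n --> \oo] --> (f x)%:E}.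
  by apply/aeW => x _; apply/fine_cvgP; split => /=; [exact: nearW|exact: cf].
have h2 : P.-integrable setT (cst 1) by exact: finite_measure_integrable_cst.
have h3 : {ae P, forall x n, setT x -> `|(f_ n x)%:E| <= (cst 1 : T -> \bar R) x}.
  apply/aeW => x n _; rewrite abse_EFin lee_fin.
  by have /andP[? ?] := f01 n x; rewrite ger0_norm.
have [] // := @dominated_convergence _ T R P setT measurableT
  (fun n x => (f_ n x)%:E) (fun x => (f x)%:E) (cst 1) _ _ h1 h2 h3.
- by move=> n; exact/measurable_EFinP.
- exact/measurable_EFinP.
Qed.

End integral_tools.

(** * Strong Markov property at the arrival times *)

Section strong_markov.
Context d (Omega : measurableType d) (R : realType) (P : probability Omega R).
Variables (W : R -> Omega -> R) (N : R -> Omega -> nat) (T : nat -> Omega -> R).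
Hypothesis hW : standard_brownian_motion P W.
Hypothesis hN : renewal_process P N T.
Hypothesis hWN : indep_systems P (sigma_process W `[0, +oo[)
                           (sigma_process N `[0, +oo[).

Lemma filtration_sub s t : s < t ->
  filtration W N s `<=` natural_filtration W N t.
Proof. by move=> st A; apply; rewrite /= in_itv/= andbT. Qed.

(* The grid time exceeds T_k by more than e, which absorbs the right limit in
   the definition of the filtration; it comes before T_(k+1) because the
   interarrival time exceeds 2 * e. *)
Lemma stopped_trace k (e : R) (j : nat) A : 0 < e ->
  stopped_sigma_algebra W N (T k) A ->
  exists2 D, joint_past W T (j.+2%:R * e) k D &
    A `&` [set w | j%:R * e <= T k w < j.+1%:R * e] `&` [set w | 2 * e < interarrival T k w]
    = D `&` [set w | 2 * e < interarrival T k w].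
Proof.
move=> e0 [_ sA].
have e0' := ltW e0.
have s1 : 0 <= j.+1%:R * e by rewrite mulr_ge0.
have s2 : 0 <= j.+2%:R * e by rewrite mulr_ge0.
have s12 : j.+1%:R * e < j.+2%:R * e by rewrite ltr_pM2r// ltr_nat.
have [D' pD' E] := natural_filtration_trace hN k s2 (filtration_sub s12 (sA _ s1)).
exists (D' `&` [set w | j%:R * e <= T k w < j.+1%:R * e]).
  rewrite -joint_pastE; apply: measurableI; first by rewrite joint_pastE.
  rewrite [X in measurable X](_ : _ = T k @^-1` `[j%:R * e, j.+1%:R * e[%classic).
    by rewrite -[X in measurable X]setTI; apply: (joint_past_arrival hN).
  by apply/seteqP; split => w /=; rewrite in_itv.
have sub w : j%:R * e <= T k w < j.+1%:R * e -> 2 * e < interarrival T k w ->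
    T k w <= j.+2%:R * e < T k.+1 w.
  move=> /andP[jT Tj] tau; rewrite (le_trans (ltW Tj) (ltW s12))/=.
  have -> : j.+2%:R * e = 2 * e + j%:R * e by rewrite -addn2 natrD; ring.
  have -> : T k.+1 w = interarrival T k w + T k w by rewrite /interarrival subrK.
  exact: ltr_leD.
apply/seteqP; split => w [[Aw Fw] tau]; split => //; split => //.
  have : (A `&` [set w | T k w <= j.+1%:R * e] `&`
    [set w | T k w <= j.+2%:R * e < T k.+1 w]) w.
    by split; [split => //=; apply: ltW; case/andP : Fw|exact: sub].
  by rewrite E => -[].
have : (D' `&` [set w | T k w <= j.+2%:R * e < T k.+1 w]) w.
  by split => //; exact: sub.
by rewrite -E => -[[]].
Qed.

(** The right end of the cell containing T_k, plus one more mesh; this is the time index of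
    [stopped_trace]. *)
Definition grid_time (k : nat) (e : R) (w : Omega) : R :=
  (Num.truncn (T k w / e)).+2%:R * e.

Lemma grid_timeE k e j w : 0 < e -> j%:R * e <= T k w < j.+1%:R * e ->
  grid_time k e w = j.+2%:R * e.
Proof.
move=> e0 jT; rewrite /grid_time (@truncn_def _ _ j)//.
by rewrite ler_pdivlMr// ltr_pdivrMr.
Qed.

Lemma grid_timeP k e w : 0 < e -> exists j : nat, j%:R * e <= T k w < j.+1%:R * e.
Proof.
move=> e0; exists (Num.truncn (T k w / e)).
by rewrite -ler_pdivlMr// -ltr_pdivrMr// truncn_itv// (divr_ge0 (arrival_ge0 hN k w) (ltW e0)).
Qed.

Lemma grid_time_bound k e w : 0 < e -> T k w <= grid_time k e w <= T k w + 2 * e.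
Proof.
move=> e0; have [j jT] := grid_timeP k w e0; rewrite (grid_timeE e0 jT).
have jE : j.+2%:R * e = j%:R * e + 2 * e by rewrite -addn2 natrD; ring.
have jE1 : j.+2%:R * e = j.+1%:R * e + e by rewrite -addn1 natrD; ring.
case/andP : jT => jT Tj; rewrite {2}jE lerD2r jT andbT jE1.
by rewrite (le_trans (ltW Tj))// lerDl ltW.
Qed.

Lemma measurable_grid_time k e : 0 < e -> measurable_fun setT (grid_time k e).
Proof.
move=> e0 _ B mB; rewrite setTI.
rewrite (_ : _ @^-1` B = \bigcup_(j in [set j : nat | B (j.+2%:R * e)])
   (T k @^-1` `[j%:R * e, j.+1%:R * e[%classic)).
  apply: bigcup_measurable => j _; rewrite -[X in measurable X]setTI.
  exact: (measurable_arrival hN).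
apply/seteqP; split => [w /=|w [j /= Bj]].
  have [j jT] := grid_timeP k w e0; rewrite (grid_timeE e0 jT) => Bj.
  by exists j => //=; rewrite in_itv.
by rewrite in_itv/= => /(grid_timeE e0) ->.
Qed.

Definition post_path (k : nat) (w : Omega) : cpathType R :=
  shifted_path W (T k w) w.

Lemma brownian_abs_continuous w : continuous (fun t : R => W `|t| w).
Proof.
have cg : continuous (fun t : R => `|t|) by move=> t; exact: norm_continuous.
have cc : continuous ((W ^~ w) \o (fun t : R => `|t|)).
  apply: (@continuous_comp_within R (W ^~ w) _ _ (@bm_continuous _ _ _ _ _ hW w) cg).
  by move=> x; rewrite /= in_itv/= andbT.
exact: cc.
Qed.

Lemma measurable_brownian_at (f : Omega -> R) : measurable_fun setT f ->
  (forall w, 0 <= f w) -> measurable_fun setT (fun w => W (f w) w).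
Proof.
move=> mf f0.
rewrite (_ : (fun _ => _) = (fun w => W `|f w| w)); last first.
  by apply/funext => w; rewrite ger0_norm.
apply: (@measurable_continuous_process _ _ R (fun w t => W `|t| w)) mf.
  exact: brownian_abs_continuous.
by move=> t; apply: (measurable_brownian hW).
Qed.

Lemma measurable_random_shift (f : Omega -> R) : measurable_fun setT f ->
  (forall w, 0 <= f w) ->
  measurable_fun setT (fun w => shifted_path W (f w) w).
Proof.
move=> mf f0; apply: measurable_cpath_valued => t.
under eq_fun do rewrite (shifted_pathE (@bm_continuous _ _ _ _ _ hW))//.
apply: measurable_funB; apply: measurable_brownian_at => //.
  by apply: measurable_funD => //; exact: measurable_cst.
by move=> w; rewrite addr_ge0.
Qed.

Lemma measurable_post_path k : measurable_fun setT (post_path k).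
Proof.
apply: measurable_random_shift; first exact: (measurable_arrival hN).
exact: (arrival_ge0 hN).
Qed.

(** The cut-off to interarrival times above 2 * e, where [stopped_trace] applies. *)
Let C2 (C : set R) (e : R) := C `&` `]2 * e, +oo[%classic.

Lemma C2E k C e : interarrival T k @^-1` C2 C e =
  (interarrival T k @^-1` C) `&` [set w | 2 * e < interarrival T k w].
Proof. by apply/seteqP; split => w /=; rewrite /C2 /= in_itv/= andbT. Qed.

(* In the second identity both sides carry the factor P(tau > 2 e), because the
   trace argument only applies on {tau_k > 2 e}; it tends to 1 with e. *)
Lemma discretized_indep k (e : R) A C (V : cpathType R -> R) : 0 < e ->
  stopped_sigma_algebra W N (T k) A -> measurable C ->
  measurable_fun setT V -> (forall x, 0 <= V x <= 1) ->
  (\int[P]_(w in A `&` interarrival T k @^-1` C2 C e)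
      (V (shifted_path W (grid_time k e w) w))%:E =
   P (A `&` interarrival T k @^-1` C2 C e) *
   \int[P]_w (V (shifted_path W 0 w))%:E)%E /\
  (P (A `&` interarrival T k @^-1` C2 C e) * P (interarrival T 0 @^-1` C2 setT e) =
   P (A `&` interarrival T k @^-1` C2 setT e) * P (interarrival T 0 @^-1` C2 C e))%E.
Proof.
move=> e0 sA mC mV V01.
have V0 x : 0 <= V x by case/andP: (V01 x).
have mA : measurable A by case: sA.
have e0' := ltW e0.
pose I j := [set w | j%:R * e <= T k w < j.+1%:R * e].
have mI j : measurable (I j).
  rewrite (_ : I j = T k @^-1` `[j%:R * e, j.+1%:R * e[%classic).
    by rewrite -[X in measurable X]setTI; exact: (measurable_arrival hN).
  by apply/seteqP; split => w /=; rewrite in_itv.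
have /choice[D DP] : forall j, exists D, joint_past W T (j.+2%:R * e) k D /\
   A `&` I j `&` [set w | 2 * e < interarrival T k w]
    = D `&` [set w | 2 * e < interarrival T k w].
  by move=> j; have [D ? ?] := stopped_trace j e0 sA; exists D.
(* On the part of the event where T_k lies in cell j, the grid time is constant and
   [joint_past_indep] applies. *)
pose F C j := A `&` interarrival T k @^-1` C2 C e `&` I j.
have mC2 (C' : set R) : measurable C' -> measurable (C2 C' e).
  by move=> mC'; apply: measurableI.
have mtau i (C' : set R) : measurable C' -> measurable (interarrival T i @^-1` C2 C' e).
  move=> mC'; rewrite -[X in measurable X]setTI.
  by apply: (measurable_interarrival hN) => //; exact: mC2.
have mF (C' : set R) j : measurable C' -> measurable (F C' j).
  by move=> mC'; apply: measurableI => //; apply: measurableI => //; exact: mtau.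
have FE (C' : set R) j : F C' j = D j `&` interarrival T k @^-1` C2 C' e.
  have [_ E] := DP j.
  rewrite /F C2E setIAC [X in _ `&` X]setIC setIA E setIAC.
  by rewrite -setIA.
have UF (C' : set R) : A `&` interarrival T k @^-1` C2 C' e = \bigcup_j F C' j.
  rewrite /F -setI_bigcupr (_ : \bigcup_j I j = setT) ?setIT//.
  by apply/seteqP; split => // w _; have [j jT] := grid_timeP k w e0; exists j.
have tF (C' : set R) : trivIset setT (F C').
  apply/trivIsetP => i j _ _ ij; apply/seteqP; split => // w [[_ Ii] [_ Ij]].
  have := grid_timeE e0 Ii; rewrite (grid_timeE e0 Ij) => /(mulIf _).
  rewrite gt_eqF// => /(_ isT)/eqP; rewrite eqr_nat => /eqP[] ji.
  by rewrite ji eqxx in ij.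
have sj j : 0 <= j.+2%:R * e by rewrite mulr_ge0.
have PF (C' : set R) j : measurable C' ->
    P (F C' j) = (P (D j) * P (interarrival T 0 @^-1` C2 C' e))%E.
  move=> mC'; have [pD _] := DP j.
  have := joint_past_indep hW hN hWN (sj j) pD (mC2 _ mC') measurableT.
  by rewrite !preimage_setT setIT probability_setT mule1 FE.
have mV' : measurable_fun setT (EFin \o V) by exact/measurable_EFinP.
split; last first.
  (* The sum over cells is the same for [C] and for [setT]; multiplying crosswise makes it common to
     both sides. *)
  have mU (C' : set R) : measurable C' -> P (A `&` interarrival T k @^-1` C2 C' e) =
      (P (interarrival T 0 @^-1` C2 C' e) * \sum_(j <oo) P (D j))%E.
    move=> mC'; rewrite UF measure_semi_bigcup//; last 2 first.
    - by move=> j; exact: mF.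
    - by apply: bigcup_measurable => j _; exact: mF.
    rewrite -[X in (X * _)%E](@fineK _ (P _)); last first.
      by apply: fin_num_measure; exact: mtau.
    rewrite -nneseriesZl//; apply: eq_eseriesr => j _.
    apply: etrans (PF C' j mC') _; rewrite muleC fineK//.
    by apply: fin_num_measure; exact: mtau.
  rewrite (mU _ mC) (mU _ measurableT).
  by rewrite -muleA muleC [X in (X * _)%E]muleC.
have mPhi : measurable_fun setT (fun w => V (shifted_path W (grid_time k e w) w)).
  apply: measurableT_comp mV _; apply: measurable_random_shift.
    exact: measurable_grid_time.
  by move=> w; rewrite /grid_time mulr_ge0.
rewrite UF ge0_integral_bigcup//; last 3 first.
- by move=> j; exact: mF.
- by apply: measurable_funTS; exact/measurable_EFinP.
- by move=> w _; rewrite lee_fin.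
rewrite measure_semi_bigcup//; last 2 first.
- by move=> j; exact: mF.
- by apply: bigcup_measurable => j _; exact: mF.
have mS0 : measurable_fun setT (shifted_path W 0).
  apply: measurable_shifted_path (lexx 0) => [w|t]; first exact: (bm_continuous hW).
  exact: (measurable_brownian hW).
set v := (\int[P]_w _)%E.
have vfin : v \is a fin_num.
  rewrite ge0_fin_numE; last by apply: integral_ge0 => w _; rewrite lee_fin.
  apply: (@le_lt_trans _ _ (\int[P]_w (cst 1%E) w)%E).
    apply: ge0_le_integral => //.
    - by move=> w _; rewrite lee_fin.
    - by apply/measurable_EFinP; exact: measurableT_comp mV mS0.
    - by move=> w _; rewrite lee_fin; case/andP: (V01 (shifted_path W 0 w)).
  by rewrite integral_cst//= mul1e ltey_eq fin_num_measure.
rewrite [RHS]muleC -(fineK vfin) -nneseriesZl//.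
apply: eq_eseriesr => j _; rewrite fineK// muleC.
transitivity (\int[P]_(w in F C j) (V (shifted_path W (j.+2%:R * e) w))%:E)%E.
  apply: eq_integral => w; rewrite inE => -[_ Ij].
  by rewrite (grid_timeE e0 Ij).
have [pD _] := DP j.
apply: (@integral_indep_event _ _ R P _ _ (F C j) _ (shifted_path W 0) (EFin \o V)) => //.
- exact: mF.
- apply: measurable_shifted_path (sj j) => [w|t]; first exact: (bm_continuous hW).
  exact: (measurable_brownian hW).
- move=> B mB; rewrite (PF C j mC) FE -setIA -muleA.
  exact: (joint_past_indep hW hN hWN (sj j) pD (mC2 _ mC) mB).
- move=> B mB; have := shifted_path_indep hW (sj j) (_ : sigma_process W `[0, j.+2%:R * e] setT) mB.
  rewrite setTI probability_setT mul1e; apply.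
  by rewrite -sigma_processE; exact: measurableT.
Qed.

(** Interarrival times are strictly positive, so the cut-off events increase to the full one. *)
Let C2_cvg k A C : measurable A -> measurable C ->
  P (A `&` interarrival T k @^-1` C2 C n.+1%:R^-1) @[n --> \oo] -->
  P (A `&` interarrival T k @^-1` C).
Proof.
move=> mA mC.
have mC2 n : measurable (A `&` interarrival T k @^-1` C2 C n.+1%:R^-1).
  apply: measurableI => //; rewrite -[X in measurable X]setTI.
  by apply: (measurable_interarrival hN) => //; apply: measurableI.
rewrite (_ : A `&` _ = \bigcup_n (A `&` interarrival T k @^-1` C2 C n.+1%:R^-1)).
  apply: nondecreasing_cvg_mu => //; first exact: bigcup_measurable.
  move=> m n mn; apply/subsetPset => w [Aw [Cw]]; rewrite /= in_itv/= andbT => e.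
  split => //; split => //=; rewrite in_itv/= andbT; apply: le_lt_trans e.
  by rewrite ler_pM2l// lef_pV2 ?posrE// ler_nat.
apply/seteqP; split => [w [Aw Cw]|w [n _ [Aw [Cw _]]]]; last by [].
have h0 : 0 < interarrival T k w / 2 by rewrite divr_gt0// (interarrival_gt0 hN).
have [n _ /(_ n (leqnn n)) nP] := near_infty_natSinv_lt (PosNum h0).
exists n => //; split => //; split => //=; rewrite in_itv/= andbT.
by rewrite mulrC -ltr_pdivlMr.
Qed.

(** Let the mesh tend to 0 in the second identity of [discretized_indep]: the sequence [a \* b] gets
    two expressions, hence two forms of its limit. *)
Lemma interarrival_indep k A C :
  stopped_sigma_algebra W N (T k) A -> measurable C ->
  P (A `&` interarrival T k @^-1` C) = (P A * P (interarrival T 0 @^-1` C))%E.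
Proof.
move=> sA mC; have mA : measurable A by case: sA.
have mt i C' : measurable C' -> measurable (interarrival T i @^-1` C').
  move=> mC'; rewrite -[X in measurable X]setTI.
  exact: (measurable_interarrival hN).
pose a n := P (A `&` interarrival T k @^-1` C2 C n.+1%:R^-1).
pose b n := P (interarrival T 0 @^-1` C2 setT n.+1%:R^-1).
have cR : (a \* b)%E @ \oo -->
    (P (A `&` interarrival T k @^-1` C) * P (interarrival T 0 @^-1` setT))%E.
  apply: cvgeM; [|exact: C2_cvg|].
    by apply: mule_def_fin; apply: fin_num_measure; [apply: measurableI => //|]; exact: mt.
  have := @C2_cvg 0 setT setT measurableT measurableT.
  by rewrite !setTI; under eq_cvg do rewrite setTI.
have cL : (a \* b)%E @ \oo -->
    (P (A `&` interarrival T k @^-1` setT) * P (interarrival T 0 @^-1` C))%E.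
  have -> : (a \* b)%E = (fun n => P (A `&` interarrival T k @^-1` C2 setT n.+1%:R^-1) *
     P (interarrival T 0 @^-1` C2 C n.+1%:R^-1))%E.
    apply/funext => n.
    have e0 : 0 < n.+1%:R^-1 :> R by rewrite invr_gt0.
    have := @discretized_indep k _ A C (cst 0) e0 sA mC (measurable_cst _).
    by case=> [x|_ <-//]; rewrite lexx ler01.
  apply: cvgeM; [|exact: C2_cvg|].
    by apply: mule_def_fin; apply: fin_num_measure; [apply: measurableI => //|]; exact: mt.
  have := @C2_cvg 0 setT C measurableT mC.
  by rewrite !setTI; under eq_cvg do rewrite setTI.
have := cvg_lim (@ereal_hausdorff R) cR.
rewrite (cvg_lim (@ereal_hausdorff R) cL).
by rewrite !preimage_setT setIT probability_setT mule1 => ->.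
Qed.

(** Grid times decrease the error to 0 and W is continuous, so the paths restarted there converge
    pointwise to [post_path]. The last hypothesis on [V] makes the integrands follow. *)
Lemma post_path_integral k A C (V : cpathType R -> R) :
  stopped_sigma_algebra W N (T k) A -> measurable C ->
  measurable_fun setT V -> (forall x, 0 <= V x <= 1) ->
  (forall (x_ : nat -> cpath R) (x : cpath R),
    (forall t, x_ ^~ t @ \oo --> (x t : R)) -> V (x_ n) @[n --> \oo] --> V x) ->
  (\int[P]_w ((\1_(A `&` interarrival T k @^-1` C) w * V (post_path k w))%:E) =
   P (A `&` interarrival T k @^-1` C) * \int[P]_w (V (shifted_path W 0 w))%:E)%E.
Proof.
move=> sA mC mV V01 cV; have mA : measurable A by case: sA.
have V0 x : 0 <= V x by case/andP: (V01 x).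
have V1 x : V x <= 1 by case/andP: (V01 x).
have e0 n : 0 < n.+1%:R^-1 :> R by rewrite invr_gt0.
pose B n := A `&` interarrival T k @^-1` C2 C n.+1%:R^-1.
have mB n : measurable (B n).
  apply: measurableI => //; rewrite -[X in measurable X]setTI.
  by apply: (measurable_interarrival hN) => //; apply: measurableI.
pose f n w := \1_(B n) w * V (shifted_path W (grid_time k n.+1%:R^-1 w) w).
have g0 n w : 0 <= grid_time k n.+1%:R^-1 w by rewrite /grid_time mulr_ge0// ltW.
have mf n : measurable_fun setT (f n).
  apply: measurable_funM; first exact: measurable_indic.
  apply: measurableT_comp mV _; apply: measurable_random_shift => //.
  exact: measurable_grid_time.
have f01 n w : 0 <= f n w <= 1.
  have i01 : 0 <= (\1_(B n) w : R) <= 1 by rewrite indicE ler0n lern1 leq_b1.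
  by case/andP : i01 => i0 i1; rewrite /f mulr_ge0//= mulr_ile1.
have cf w : f ^~ w @ \oo --> \1_(A `&` interarrival T k @^-1` C) w * V (post_path k w).
  apply: cvgM; last first.
    apply: cV => t; rewrite /post_path.
    rewrite (shifted_pathE (@bm_continuous _ _ _ _ _ hW)) ?(arrival_ge0 hN)//.
    under eq_fun do rewrite (shifted_pathE (@bm_continuous _ _ _ _ _ hW))//.
    have cg : grid_time k n.+1%:R^-1 w @[n --> \oo] --> T k w.
      have ce : T k w + 2 * (n.+1%:R^-1 : R) @[n --> \oo] --> T k w.
        rewrite -[X in _ --> X]addr0; apply: cvgD; first exact: cvg_cst.
        rewrite -[X in _ --> X](mulr0 2); apply: cvgM; first exact: cvg_cst.
        exact: cvg_harmonic.
      apply: (squeeze_cvgr _ (cvg_cst (T k w)) ce); apply: nearW => n.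
      exact: grid_time_bound.
    have cW (t' : R) : W (grid_time k n.+1%:R^-1 w + `|t'|) w @[n --> \oo] --> W (T k w + `|t'|) w.
      have cs : grid_time k n.+1%:R^-1 w + `|t'| @[n --> \oo] --> T k w + `|t'|.
        by apply: cvgD => //; exact: cvg_cst.
      have H : W `|grid_time k n.+1%:R^-1 w + `|t'| | w @[n --> \oo] -->
          W `|T k w + `|t'| | w.
        apply: (@continuous_cvg _ _ _ _ _ (fun n : nat => grid_time k n.+1%:R^-1 w + `|t'|)
          (fun t : R => W `|t| w)) => //; exact: brownian_abs_continuous.
      rewrite (@ger0_norm _ (T k w + `|t'|)) ?addr_ge0 ?(arrival_ge0 hN)// in H.
      rewrite (_ : (fun _ => _) = (fun n : nat => W `|grid_time k n.+1%:R^-1 w + `|t'| | w))//.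
      by apply/funext => n; rewrite (@ger0_norm _ (_ + _)) ?addr_ge0.
    apply: cvgB; first exact: cW.
    by have := cW 0; rewrite normr0 addr0; under eq_fun do rewrite addr0.
  have [[Aw Cw]|nB] := pselect ((A `&` interarrival T k @^-1` C) w).
    (* For large n the cut-off 2 / (n + 1) lies below the given positive interarrival time, so the
       indicator is eventually constant. *)
    apply: cvg_near_cst.
    have h0 : 0 < interarrival T k w / 2 by rewrite divr_gt0// (interarrival_gt0 hN).
    near=> n; rewrite !indicE !mem_set//; split => //; split => //=.
    rewrite in_itv/= andbT mulrC -ltr_pdivlMr//.
    by near: n; exact: (near_infty_natSinv_lt (PosNum h0)).
  apply: cvg_near_cst; apply: nearW => n; rewrite !indicE !memNset//.
  by move=> [Aw [Cw _]]; apply: nB.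
have cI := @bounded_convergence _ _ _ P _ _ mf f01 cf.
have fE n : (\int[P]_w (f n w)%:E =
   P (B n) * \int[P]_w (V (shifted_path W 0 w))%:E)%E.
  have [<- _] := @discretized_indep k _ A C V (e0 n) sA mC mV V01.
  rewrite [RHS]integral_mkcond; apply: eq_integral => w _.
  by rewrite patchE /f indicE; case: ifPn => _; rewrite ?mul1r ?mul0r.
rewrite -(cvg_lim (@ereal_hausdorff R) cI); apply/cvg_lim => //.
under eq_cvg do rewrite fE.
apply: cvgeZr; last exact: C2_cvg.
have mS0 : measurable_fun setT (shifted_path W 0).
  apply: measurable_shifted_path (lexx 0) => [w|t]; first exact: (bm_continuous hW).
  exact: (measurable_brownian hW).
rewrite ge0_fin_numE; last by apply: integral_ge0 => w _; rewrite lee_fin.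
apply: (@le_lt_trans _ _ (\int[P]_w (cst 1%E) w)%E).
  apply: ge0_le_integral => //.
  - by move=> w _; rewrite lee_fin.
  - by apply/measurable_EFinP; exact: measurableT_comp mV mS0.
  - by move=> w _; rewrite lee_fin.
by rewrite integral_cst//= mul1e ltey_eq fin_num_measure.
Unshelve. all: by end_near. Qed.

End strong_markov.

(** * Continuous approximation of cylinder indicators *)

Definition ramp (R : realType) (n : nat) (x : R) : R :=
  Num.min 1 (n%:R * Num.max 0 x).

Lemma ramp_ge0_le1 (R : realType) n (x : R) : 0 <= ramp n x <= 1.
Proof.
by rewrite /ramp le_min ler01 ge_min lexx/= andbT mulr_ge0// le_max lexx.
Qed.

Lemma ramp_continuous (R : realType) n : continuous (@ramp R n).
Proof.
move=> x.
have c0 (c : R) : {for x, continuous (fun=> c : R^o)} by exact: cvg_cst.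
have cm : {for x, continuous ((fun=> 0 : R^o) \max (fun y : R => y : R^o))}.
  by apply: continuous_max (c0 0) _; exact: cvg_id.
have cM : {for x, continuous (fun y : R => n%:R * Num.max 0 y : R^o)}.
  by apply: cvgM; [exact: cvg_cst|exact: cm].
exact: (continuous_min (c0 1) cM).
Qed.

Lemma cvg_ramp (R : realType) (x : R) :
  ramp n x @[n --> \oo] --> ((0 < x)%R%:R : R).
Proof.
apply: cvg_near_cst; have [x0|x0] := ltP 0 x; last first.
  by apply: nearW => n; rewrite /ramp max_l// mulr0 min_r.
near=> n; rewrite /ramp max_r ?ltW// min_l//.
rewrite -ler_pdivrMr// mul1r; near: n; exact: nbhs_infty_ger.
Unshelve. all: by end_near. Qed.

(** Unlike the indicator of a cylinder, this function is continuous for pointwise convergence of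
    paths and so is a legitimate [V] in [post_path_integral]. *)
Definition soft_cylinder (R : realType) n (L : seq (R * R)) (w : cpath R) : R :=
  \prod_(p <- L) ramp n (w p.1 - p.2).

Lemma soft_cylinder_ge0_le1 (R : realType) n L (w : cpath R) :
  0 <= soft_cylinder n L w <= 1.
Proof.
rewrite /soft_cylinder; elim/big_rec : _ => [|p x _ /andP[x0 x1]].
  by rewrite ler01 lexx.
have /andP[r0 r1] := ramp_ge0_le1 n (w p.1 - p.2).
by rewrite mulr_ge0//= mulr_ile1.
Qed.

Lemma measurable_soft_cylinder (R : realType) n (L : seq (R * R)) :
  measurable_fun [set: cpathType R] (soft_cylinder n L : cpathType R -> R).
Proof.
elim: L => [|p L IH].
  rewrite (_ : soft_cylinder n [::] = cst 1); first exact: measurable_cst.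
  by apply/funext => w; rewrite /soft_cylinder big_nil.
rewrite (_ : soft_cylinder n (p :: L) =
    (fun w => ramp n (w p.1 - p.2) * soft_cylinder n L w)); last first.
  by apply/funext => w; rewrite /soft_cylinder big_cons.
apply: measurable_funM => //.
apply: (@measurableT_comp _ _ _ _ _ _ (@ramp R n)).
  exact: continuous_measurable_fun (@ramp_continuous R n).
by apply: measurable_funB; [exact: measurable_cpath_eval|exact: measurable_cst].
Qed.

Lemma soft_cylinder_cvg_path (R : realType) n (L : seq (R * R))
    (w_ : nat -> cpath R) (w : cpath R) :
  (forall t, w_ ^~ t @ \oo --> (w t : R)) ->
  soft_cylinder n L (w_ m) @[m --> \oo] --> soft_cylinder n L w.
Proof.
move=> cw; rewrite /soft_cylinder; elim: L => [|p L IH].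
  by rewrite big_nil; under eq_fun do rewrite big_nil; exact: cvg_cst.
rewrite big_cons; under eq_fun do rewrite big_cons.
apply: cvgM => //.
apply: (@continuous_cvg _ _ _ _ _ (fun m => w_ m p.1 - p.2) (@ramp R n)).
  exact: ramp_continuous.
by apply: cvgB => //; exact: cvg_cst.
Qed.

Lemma soft_cylinder_cvg (R : realType) (L : seq (R * R)) (w : cpath R) :
  soft_cylinder n L w @[n --> \oo] --> (\1_(cylinder L) w : R).
Proof.
rewrite /soft_cylinder; elim: L => [|p L IH].
  under eq_fun do rewrite big_nil.
  by rewrite indicE mem_set//; exact: cvg_cst.
under eq_fun do rewrite big_cons.
rewrite (_ : \1_(cylinder (p :: L)) w = (0 < w p.1 - p.2)%R%:R * \1_(cylinder L) w).
  by apply: cvgM => //; exact: cvg_ramp.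
rewrite !indicE -natrM mulnb subr_gt0; congr (_ %:R); congr nat_of_bool.
apply/idP/idP; rewrite ?inE => H.
  apply/andP; split; first by apply: H; rewrite mem_head.
  by rewrite inE => q qL; apply: H; rewrite inE qL orbT.
case/andP: H => H0; rewrite inE => HL q; rewrite inE => /predU1P[->//|/HL//].
Qed.

(** * Independence and common law of the step data *)

Section step_law.
Context d (Omega : measurableType d) (R : realType) (P : probability Omega R).
Variables (W : R -> Omega -> R) (N : R -> Omega -> nat) (T : nat -> Omega -> R).
Hypothesis hW : standard_brownian_motion P W.
Hypothesis hN : renewal_process P N T.
Hypothesis hWN : indep_systems P (sigma_process W `[0, +oo[)
                           (sigma_process N `[0, +oo[).

Let mS0 : measurable_fun setT (shifted_path W 0).
Proof.
apply: measurable_shifted_path (lexx 0) => [w|t]; first exact: (bm_continuous hW).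
exact: (measurable_brownian hW).
Qed.

(** Take soft cylinders in [post_path_integral] and let the ramps steepen; bounded convergence
    applies on both sides. *)
Lemma post_path_cylinder k A C L :
  stopped_sigma_algebra W N (T k) A -> measurable C ->
  P (A `&` interarrival T k @^-1` C `&` post_path W T k @^-1` cylinder L) =
  (P (A `&` interarrival T k @^-1` C) * P (shifted_path W 0 @^-1` cylinder L))%E.
Proof.
move=> sA mC.
have mA : measurable A by case: sA.
have mAC : measurable (A `&` interarrival T k @^-1` C).
  apply: measurableI => //; rewrite -[X in measurable X]setTI.
  exact: (measurable_interarrival hN).
have mL : measurable (cylinder L : set (cpathType R)).
  by apply: sub_sigma_algebra; exists L.
have mpL (X : Omega -> cpathType R) : measurable_fun setT X -> measurable (X @^-1` cylinder L).
  by move=> mX; rewrite -[Y in measurable Y]setTI; exact: mX.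
have mpp := measurable_post_path hW hN k.
have [i0 i1] : (forall w, 0 <= (\1_(A `&` interarrival T k @^-1` C) w : R)) /\
    (forall w, (\1_(A `&` interarrival T k @^-1` C) w : R) <= 1).
  by split=> w; rewrite indicE ?ler0n// lern1 leq_b1.
have c1 : (\int[P]_w (\1_(A `&` interarrival T k @^-1` C) w *
       soft_cylinder n L (post_path W T k w))%:E @[n --> \oo] -->
    \int[P]_w (\1_(A `&` interarrival T k @^-1` C) w *
       \1_(cylinder L) (post_path W T k w))%:E)%E.
  apply: bounded_convergence => [n|n w|w].
  - apply: measurable_funM; first exact: measurable_indic.
    exact: measurableT_comp (measurable_soft_cylinder n L) mpp.
  - have /andP[s0 s1] := soft_cylinder_ge0_le1 n L (post_path W T k w).
    by rewrite mulr_ge0//= mulr_ile1.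
  - by apply: cvgM; [exact: cvg_cst|exact: soft_cylinder_cvg].
have c2 : (\int[P]_w (soft_cylinder n L (shifted_path W 0 w))%:E @[n --> \oo] -->
    \int[P]_w (\1_(cylinder L) (shifted_path W 0 w))%:E)%E.
  apply: bounded_convergence => [n|n w|w].
  - exact: measurableT_comp (measurable_soft_cylinder n L) mS0.
  - exact: soft_cylinder_ge0_le1.
  - exact: soft_cylinder_cvg.
have c3 : (P (A `&` interarrival T k @^-1` C) *
    \int[P]_w (soft_cylinder n L (shifted_path W 0 w))%:E @[n --> \oo] -->
    P (A `&` interarrival T k @^-1` C) *
    \int[P]_w (\1_(cylinder L) (shifted_path W 0 w))%:E)%E.
  by apply: cvgeZl => //; exact: fin_num_measure.
have E : (P (A `&` interarrival T k @^-1` C) *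
    \int[P]_w (\1_(cylinder L) (shifted_path W 0 w))%:E)%E =
    (\int[P]_w (\1_(A `&` interarrival T k @^-1` C) w *
       \1_(cylinder L) (post_path W T k w))%:E)%E.
  rewrite -(cvg_lim (@ereal_hausdorff R) c1) -(cvg_lim (@ereal_hausdorff R) c3).
  apply/congr_lim/funext => n.
  rewrite (post_path_integral hW hN hWN sA mC (measurable_soft_cylinder n L))//.
    exact: soft_cylinder_ge0_le1.
  exact: soft_cylinder_cvg_path.
rewrite (_ : (\int[P]_w (\1_(cylinder L) (shifted_path W 0 w))%:E)%E =
    P (shifted_path W 0 @^-1` cylinder L)) in E; last first.
  rewrite -[in RHS](setIT (_ @^-1` _)) -integral_indic//.
  exact: mpL.
rewrite E.
rewrite -[X in P X](setIT) -integral_indic//; last first.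
  by apply: measurableI => //; exact: mpL.
by apply: eq_integral => w _; rewrite indicI.
Qed.

Definition step_data (k : nat) (w : Omega) : R * cpathType R :=
  (interarrival T k w, post_path W T k w).

Lemma measurable_step_data k : measurable_fun setT (step_data k).
Proof.
apply: measurable_fun_pair; first exact: (measurable_interarrival hN).
exact: (measurable_post_path hW hN).
Qed.

Lemma post_path_indep k A C B :
  stopped_sigma_algebra W N (T k) A -> measurable C -> measurable B ->
  P (A `&` interarrival T k @^-1` C `&` post_path W T k @^-1` B) =
  (P A * (P (interarrival T 0 @^-1` C) * P (shifted_path W 0 @^-1` B)))%E.
Proof.
move=> sA mC mB.
have mA : measurable A by case: sA.
have mAC : measurable (A `&` interarrival T k @^-1` C).
  apply: measurableI => //; rewrite -[X in measurable X]setTI.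
  exact: (measurable_interarrival hN).
rewrite muleA -(interarrival_indep hW hN hWN sA mC).
apply: (@indep_law _ _ _ _ (cpathType R) P (range (@cylinder R)) _
  (post_path W T k) (shifted_path W 0)) => //.
- exact: cylinder_setI.
- exact: (measurable_post_path hW hN).
- by move=> _ [L _ <-]; exact: post_path_cylinder.
Qed.

(** This says that T_k is a stopping time: T_k <= t means N_t >= k. *)
Lemma stopped_sigma_algebraT k : stopped_sigma_algebra W N (T k) setT.
Proof.
split=> // t t0; rewrite setTI => s; rewrite /= in_itv/= andbT => ts.
apply: sub_sigma_algebra; right; apply: sub_sigma_algebra.
exists t; first by rewrite /= in_itv/= t0 ltW.
exists [set n | (k <= n)%N] => //; rewrite setTI.
by apply/seteqP; split => w /=; rewrite (rp_count hN).
Qed.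

(** Rectangles are a pi-system generating the product sigma-algebra, and on them [post_path_indep]
    gives the factors. Since these do not depend on [k], the law is that of [step_data 0]. *)
Lemma step_data_indep k A B :
  stopped_sigma_algebra W N (T k) A -> measurable B ->
  P (A `&` step_data k @^-1` B) = (P A * P (step_data 0 @^-1` B))%E.
Proof.
move=> sA mB; have mA : measurable A by case: sA.
pose G := [set X `*` Y | X in @measurable _ R & Y in @measurable _ (cpathType R)].
apply: (@indep_law _ _ _ _ (R * cpathType R)%type P G _ (step_data k) (step_data 0)) => //.
- exact: measurable_prod_measurableType.
- move=> _ _ [X mX [Y mY <-]] [X' mX' [Y' mY' <-]].
  exists (X `&` X'); first exact: measurableI.
  by exists (Y `&` Y'); [exact: measurableI|rewrite setXI].
- exact: measurable_step_data.
- exact: measurable_step_data.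
move=> _ [X mX [Y mY <-]].
have E i A' : A' `&` step_data i @^-1` (X `*` Y) =
    A' `&` interarrival T i @^-1` X `&` post_path W T i @^-1` Y.
  by rewrite -setIA; congr (_ `&` _); apply/seteqP; split => w.
rewrite E post_path_indep// -(setTI (step_data 0 @^-1` _)) E.
by rewrite (post_path_indep (stopped_sigma_algebraT 0))// probability_setT mul1e.
Qed.

End step_law.

(** * One step of the drawdown chain *)

Section drawdown_step.
Context (R : realType).
Variables eta theta sigma : R.

Definition segment (b : R) (w : cpath R) (t : R) : R :=
  drift eta theta b * t + volatility sigma b * w t.

(* The time interval [0, tau] is rescaled to [0, 1] so that its length can vary
   measurably. *)
Definition segment_sup (b : R) (x : R * cpath R) : R :=
  sup [set segment b x.2 (s * x.1) | s in `[0, 1]%classic].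

Definition drawdown_step (z b : R) (x : R * cpathType R) : R :=
  Num.max z (segment_sup b x) - segment b x.2 x.1.

Lemma segment_continuous b (x : R * cpath R) :
  continuous (fun s : R => segment b x.2 (s * x.1)).
Proof.
have cs : continuous (fun s : R => s * x.1).
  by move=> s; apply: cvgM; [exact: cvg_id|exact: cvg_cst].
have cw : continuous ((x.2 : R -> R) \o (fun s : R => s * x.1)).
  by move=> s; apply: continuous_comp; [exact: cs|exact: cpath_continuous].
move=> s; apply: cvgD; apply: cvgM; [exact: cvg_cst|exact: cs|exact: cvg_cst|exact: cw].
Qed.

Lemma continuous_itv_has_ub (f : R -> R) (a b : R) : {within `[a, b], continuous f} ->
  has_ubound [set f s | s in `[a, b]%classic].
Proof.
move=> cf; have [ab|ba] := leP a b; last first.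
  by exists 0 => _ [s /= + <-]; rewrite in_itv/= => /andP[/le_trans] /[apply]; rewrite leNgt ba.
have [c _ cM] := EVT_max ab cf.
by exists (f c) => _ [s sab <-]; exact: cM.
Qed.

Lemma segment_has_sup b (x : R * cpath R) :
  has_sup [set segment b x.2 (s * x.1) | s in `[0, 1]%classic].
Proof.
split.
  by exists (segment b x.2 (0 * x.1)), 0 => //=; rewrite in_itv/= lexx ler01.
apply: continuous_itv_has_ub; apply: continuous_subspaceT.
exact: segment_continuous.
Qed.

Definition clamp01 (s : R) : R := Num.max 0 (Num.min 1 s).

Lemma clamp01_itv s : clamp01 s \in `[0, 1].
Proof. by rewrite in_itv/= /clamp01 le_max lexx/= ge_max ler01 ge_min lexx. Qed.

Lemma clamp01_id s : s \in `[0, 1] -> clamp01 s = s.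
Proof. by rewrite in_itv/= => /andP[s0 s1]; rewrite /clamp01 min_r// max_r. Qed.

Lemma clamp01_continuous : continuous clamp01.
Proof.
move=> x.
have c0 (c : R) : {for x, continuous (fun=> c : R^o)} by exact: cvg_cst.
have cm : {for x, continuous ((fun=> 1 : R^o) \min (fun y : R => y : R^o))}.
  by apply: continuous_min (c0 1) _; exact: cvg_id.
exact: (continuous_max (c0 0) cm).
Qed.

(** By continuity the supremum is reached along the rationals, clamped to [0, 1]. This countable
    family of times is the same for all paths and controls, whence measurability of the supremum. *)
Lemma segment_sup_gt a b (x : R * cpath R) :
  a < segment_sup b x <-> exists q : rat,
    a < segment b x.2 (clamp01 (ratr q) * x.1).
Proof.
split => [/(sup_gt (segment_has_sup b x).1)|[q aq]]; last first.
  apply: (lt_le_trans aq); apply: ub_le_sup; first exact: (segment_has_sup b x).2.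
  by exists (clamp01 (ratr q)) => //=; exact: clamp01_itv.
move=> [_ [s /= s01 <-] as_].
pose f s := segment b x.2 (clamp01 s * x.1).
have cf : continuous f.
  move=> u; apply: (@continuous_comp _ _ _ clamp01 (fun s : R => segment b x.2 (s * x.1))).
    exact: clamp01_continuous.
  exact: segment_continuous.
have oO : open (f @^-1` [set y | a < y]).
  by apply: open_comp; [move=> y _; exact: cf|exact: open_gt].
have [|u [aq [q _ qu]]] := @dense_rat R _ _ oO; last first.
  by exists q; rewrite qu.
by exists s; rewrite /= /f clamp01_id.
Qed.

Lemma measurable_segment d (T : measurableType d) (b t : T -> R)
    (w : T -> cpathType R) :
  measurable_fun setT b -> measurable_fun setT t -> measurable_fun setT w ->
  measurable_fun setT (fun y => segment (b y) (w y) (t y)).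
Proof.
move=> mb mt mw.
have mwt : measurable_fun setT (fun y => (w y : cpath R) (t y)).
  apply: (measurable_continuous_process (Y := fun y => (w y : cpath R))) mt.
    by move=> y; exact: cpath_continuous.
  move=> s; apply: (measurableT_comp (measurable_cpath_eval s) mw).
apply: measurable_funD; apply: measurable_funM => //.
- apply: measurable_funB; first exact: measurable_cst.
  apply: measurable_funM; last exact: measurable_cst.
  by apply: measurable_funB => //; exact: measurable_cst.
- by apply: measurable_funM => //; exact: measurable_cst.
Qed.

Lemma measurable_drawdown_step d (T : measurableType d) (z b t : T -> R)
    (w : T -> cpathType R) :
  measurable_fun setT z -> measurable_fun setT b -> measurable_fun setT t ->
  measurable_fun setT w ->
  measurable_fun setT (fun y => drawdown_step (z y) (b y) (t y, w y)).
Proof.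
move=> mz mb mt mw; apply: measurable_funB; last exact: measurable_segment.
apply: measurable_maxr => //.
apply: (measurability _ (RGenOInfty.measurableE R)) => _ [_ [a ->] <-].
rewrite setTI (_ : _ @^-1` _ = \bigcup_(q : rat)
  ((fun y => segment (b y) (w y) (clamp01 (ratr q) * t y)) @^-1` `]a, +oo[%classic)).
  apply: bigcupT_measurable_rat => q; rewrite -[X in measurable X]setTI.
  apply: measurable_segment => //; apply: measurable_funM => //; exact: measurable_cst.
apply/seteqP; split => [y /=|y [q _ /=]]; rewrite !in_itv/= !andbT.
  by move=> /segment_sup_gt[q aq]; exists q => //=; rewrite in_itv/= andbT.
by move=> aq; apply/segment_sup_gt; exists q.
Qed.

(** The segment is affine in [b], and its slope is a continuous function of time, bounded on the
    compact interval. *)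
Lemma segment_lipschitz (x : R * cpath R) : exists2 K, 0 <= K &
  forall b b' s, s \in `[0, 1] ->
    segment b x.2 (s * x.1) <= segment b' x.2 (s * x.1) + K * `|b - b'|.
Proof.
pose f s : R := `|theta * (s * x.1) + sigma * x.2 (s * x.1)|.
have cs : continuous (fun s : R => s * x.1).
  by move=> s; apply: cvgM; [exact: cvg_id|exact: cvg_cst].
have cw : continuous ((x.2 : R -> R) \o (fun s : R => s * x.1)).
  by move=> s; apply: continuous_comp; [exact: cs|exact: cpath_continuous].
have cf : continuous f.
  move=> s; apply: (cvg_norm (f := fun s => theta * (s * x.1) + sigma * x.2 (s * x.1))).
  by apply: cvgD; apply: cvgM; [exact: cvg_cst|exact: cs|exact: cvg_cst|exact: cw].
have [|M Mub] := @continuous_itv_has_ub f 0 1; first exact: continuous_subspaceT.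
exists M => [|b b' s s01].
  apply: (le_trans (normr_ge0 (theta * (0 * x.1) + sigma * x.2 (0 * x.1)))).
  by apply: Mub; exists 0 => //=; rewrite in_itv/= lexx ler01.
rewrite -lerBlDl.
have -> : segment b x.2 (s * x.1) - segment b' x.2 (s * x.1) =
   (theta * (s * x.1) + sigma * x.2 (s * x.1)) * (b - b').
  by rewrite /segment /drift /volatility; ring.
apply: (le_trans (ler_norm _)); rewrite normrM ler_wpM2r//.
by apply: Mub; exists s.
Qed.

(** A supremum of uniformly Lipschitz functions is Lipschitz. The constant in [b] is 2 * K, one K
    from the supremum and one from the end value. *)
Lemma drawdown_step_continuous (x : R * cpathType R) :
  continuous (fun p : R * R => drawdown_step p.1 p.2 x).
Proof.
have [K K0 KP] := segment_lipschitz x.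
have sup_le b b' : segment_sup b x <= segment_sup b' x + K * `|b - b'|.
  apply: ge_sup; first exact: (segment_has_sup b x).1.
  move=> _ [s s01 <-]; apply: (le_trans (KP b b' s s01)); rewrite lerD2r.
  by apply: ub_le_sup; [exact: (segment_has_sup b' x).2|exists s].
have s1 b b' : segment b x.2 x.1 <= segment b' x.2 x.1 + K * `|b - b'|.
  by have := KP b b' 1; rewrite mul1r in_itv/= ler01 lexx; exact.
have le z b z' b' : drawdown_step z b x <=
    drawdown_step z' b' x + (`|z - z'| + 2 * K * `|b - b'|).
  have : Num.max z (segment_sup b x) <=
     Num.max z' (segment_sup b' x) + (`|z - z'| + K * `|b - b'|).
    rewrite ge_max; apply/andP; split.
      apply: (@le_trans _ _ (z' + `|z - z'|)).
        by rewrite -lerBlDl ler_norm.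
      apply: lerD; first by rewrite le_max lexx.
      by rewrite lerDl mulr_ge0.
    apply: (le_trans (sup_le b b')); apply: lerD; first by rewrite le_max lexx orbT.
    by rewrite lerDr.
  by have := s1 b' b; rewrite (distrC b' b) /drawdown_step; lra.
have dist z b z' b' : `|drawdown_step z b x - drawdown_step z' b' x| <=
    `|z - z'| + 2 * K * `|b - b'|.
  by rewrite ler_distlC; have := le z b z' b'; have := le z' b' z b;
    rewrite (distrC z' z) (distrC b' b) => h1 h2; apply/andP; split; lra.
move=> [z b] /=; apply/cvgrPdist_lt => e e0.
have g0 : `|z - p.1| + 2 * K * `|b - p.2| @[p --> (z, b)] --> (0 : R).
  rewrite -[X in _ --> X]addr0; apply: cvgD.
    rewrite -(normr0 R) -(subrr z); apply: cvg_norm.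
    by apply: cvgB; [exact: cvg_cst|exact: cvg_fst].
  rewrite -[X in _ --> X](mulr0 (2 * K)); apply: cvgM; first exact: cvg_cst.
  rewrite -(normr0 R) -(subrr b); apply: cvg_norm.
  by apply: cvgB; [exact: cvg_cst|exact: cvg_snd].
near=> p; apply: (le_lt_trans (dist _ _ _ _)).
have : `|0 - (`|z - p.1| + 2 * K * `|b - p.2|)| < e.
  by near: p; exact: (cvgrPdist_lt _ _).1 g0 _ e0.
by rewrite sub0r normrN; apply: le_lt_trans; exact: ler_norm.
Unshelve. all: by end_near. Qed.

End drawdown_step.

(** * Lower semicontinuous functions and value iteration *)

Section lower_semicontinuity.
Context (R : realType).
Local Open Scope ereal_scope.

Lemma ereal_lt_dense_real (x y : \bar R) : x < y ->
  exists r : R, x < r%:E < y.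
Proof.
move: x y => [x| |] [y| |] // xy.
- exists ((x + y) / 2)%R; rewrite !lte_fin in xy *.
  by rewrite midf_lt//= midf_lt.
- by exists (x + 1)%R; rewrite lte_fin ltrDl ltr01/= ltry.
- by exists (y - 1)%R; rewrite ltNyr lte_fin/= ltrBlDr ltrDl ltr01.
- by exists 0%R; rewrite ltNyr ltry.
Qed.

Definition lsc (X : topologicalType) (f : X -> \bar R) :=
  forall x (a : R), a%:E < f x -> \forall y \near x, a%:E < f y.

Lemma lsc_measurable (f : R -> \bar R) : lsc f -> measurable_fun setT f.
Proof.
move=> lf; apply: lower_semicontinuous_measurable => x a /lf H.
by exists [set y | a%:E < f y].
Qed.

Lemma lsc_limn_einf (X : topologicalType) (f : X -> \bar R) (x_ : nat -> X) x :
  lsc f -> x_ @ \oo --> x -> f x <= limn_einf (fun n => f (x_ n)).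
Proof.
move=> lf cx; rewrite limn_einf_lim (cvg_lim (@ereal_hausdorff R) (@cvg_einfs_sup R _)).
rewrite leNgt; apply/negP => /ereal_lt_dense_real[a /andP[sa af]].
have [N _ HN] : \forall n \near \oo, a%:E < f (x_ n) := cx _ (lf _ _ af).
move: sa; apply/negP; rewrite -leNgt.
apply: (@le_trans _ _ (einfs (fun n => f (x_ n)) N)); last first.
  by apply: ereal_sup_ubound; exists N.
by apply: le_ereal_inf_tmp => _ [n /= Nn <-]; exact/ltW/HN.
Qed.

(** Sequential criterion, the form in which Fatou's lemma delivers lower semicontinuity. *)
Lemma seq_lsc (X : pseudoMetricType R) (f : X -> \bar R) :
  (forall (x_ : nat -> X) x, x_ @ \oo --> x ->
     f x <= limn_einf (fun n => f (x_ n))) -> lsc f.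
Proof.
move=> sf x a af; apply: contrapT => nN.
have /choice[y yP] : forall n, exists y, ball x n.+1%:R^-1 y /\ f y <= a%:E.
  move=> n; apply: contrapT => /forallNP H; apply: nN.
  have n0 : (0 < n.+1%:R^-1 :> R)%R by rewrite invr_gt0.
  apply/nbhs_ballP; exists n.+1%:R^-1%R => //= y xy.
  by rewrite ltNge; apply/negP => fa; apply: (H y).
have cy : y @ \oo --> x.
  apply/cvg_ballP => e e0; near=> n.
  apply: (@le_ball _ _ _ n.+1%:R^-1); last by case: (yP n).
  by apply: ltW; near: n; exact: (near_infty_natSinv_lt (PosNum e0)).
have := sf _ _ cy; apply/negP; rewrite -ltNge; apply: le_lt_trans af.
rewrite limn_einf_lim (cvg_lim (@ereal_hausdorff R) (@cvg_einfs_sup R _)).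
apply: ge_ereal_sup => _ [n _ <-].
apply: (@le_trans _ _ (f (y n))); last by case: (yP n).
by apply: ereal_inf_lbound; exists n => /=.
Unshelve. all: by end_near. Qed.

Lemma lsc_pair_right (X Y : topologicalType) (f : X -> Y -> \bar R) (x : X) :
  lsc (fun p => f p.1 p.2) -> lsc (f x).
Proof.
move=> lf y a af; have [[A B] [/= Ax By] AB] := lf (x, y) a af.
by apply: filterS By => z Bz; apply: (AB (x, z)); split => //=; exact: nbhs_singleton.
Qed.

Lemma lsc_inf_compact (X Y : topologicalType) (K : set Y) (f : X -> Y -> \bar R) :
  compact K -> lsc (fun p => f p.1 p.2) ->
  lsc (fun x => ereal_inf [set f x y | y in K]).
Proof.
(* The bound c is strictly between a and the infimum, because strict bounds f x' y > c only give an
   infimum at least c. *)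
move=> /compact_near_coveringP cK lf x a /ereal_lt_dense_real[c /andP[ac cf]].
have /(cK _ (nbhs x) (fun x' y' => c%:E < f x' y') _) :
    forall y, K y -> \forall y' \near y & x' \near nbhs x, c%:E < f x' y'.
  move=> y Ky; have cy : c%:E < f x y.
    by apply: lt_le_trans cf _; apply: ereal_inf_lbound; exists y.
  have [[A B] [/= Ax By] AB] := lf (x, y) c cy.
  by exists (B, A) => //= -[y' x'] [/= By' Ax']; exact: (AB (x', y')).
apply: filterS => x' cx'; apply: (lt_le_trans ac).
by apply: le_ereal_inf_tmp => _ [y Ky <-]; exact/ltW/cx'.
Qed.

Lemma lsc_compact_min (Y : topologicalType) (K : set Y) (f : Y -> \bar R) :
  compact K -> K !=set0 -> (forall y, 0 <= f y) -> lsc f ->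
  exists2 y, K y & f y = ereal_inf [set f y | y in K].
Proof.
move=> /compact_near_coveringP cK [y0 Ky0] f0 lf.
apply: contrapT => /forall2NP H; set m := ereal_inf _ in H.
have mf y : K y -> m < f y.
  move=> Ky; rewrite lt_neqAle; apply/andP; split; last first.
    by apply: ereal_inf_lbound; exists y.
  by have [//|/eqP] := H y; rewrite eq_sym.
have m0 : 0 <= m by apply: le_ereal_inf_tmp => _ [y _ <-].
have mfin : m \is a fin_num.
  by rewrite ge0_fin_numE//; apply: lt_le_trans (mf _ Ky0) (leey _).
have /(cK _ _ (fun a y' => a%:E < f y') _) : forall y, K y ->
    \forall y' \near y & a \near (fine m)^'+, a%:E < f y'.
  move=> y /mf /ereal_lt_dense_real[c /andP[mc cf]].
  exists ([set y' | c%:E < f y'], [set a | (a < c)%R]) => /=.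
    split; first exact: lf.
    by apply: nbhs_right_lt; rewrite -lte_fin fineK.
  by move=> [y' a] [/= cy' ac]; rewrite (lt_trans _ cy')// lte_fin.
move=> Hn; have /filter_ex[a [aK am]] :
    \forall a \near (fine m)^'+, K `<=` (fun y => a%:E < f y) /\ (fine m < a)%R.
  by apply: filterI => //; exact: nbhs_right_gt.
have : m < a%:E by rewrite -(fineK mfin) lte_fin.
apply/negP; rewrite -leNgt; apply: le_ereal_inf_tmp => _ [y Ky <-].
exact/ltW/aK.
Qed.

(** Dini's argument: the sets where f_n > a are open, increase with n and cover [K], so a single n
    serves for all of [K]. *)
Lemma inf_sup_compact (Y : topologicalType) (K : set Y) (f_ : nat -> Y -> \bar R)
    (f : Y -> \bar R) (a : R) :
  compact K -> (forall n, lsc (f_ n)) ->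
  (forall y m n, (m <= n)%N -> f_ m y <= f_ n y) ->
  (forall y b, K y -> b%:E < f y -> exists n, b%:E < f_ n y) ->
  a%:E < ereal_inf [set f y | y in K] ->
  exists n, a%:E <= ereal_inf [set f_ n y | y in K].
Proof.
move=> /compact_near_coveringP cK lf nd fsup af.
have /(cK _ _ (fun n y' => a%:E < f_ n y') _) :
    forall y, K y -> \forall y' \near y & n \near \oo, a%:E < f_ n y'.
  move=> y Ky; have [|n0 an0] := fsup y a Ky.
    by apply: lt_le_trans af _; apply: ereal_inf_lbound; exists y.
  exists ([set y' | a%:E < f_ n0 y'], [set n | (n0 <= n)%N]) => /=.
    split; first exact: lf.
    by exists n0.
  by move=> [y' n] [/= ay' nn]; apply: lt_le_trans ay' _; exact: nd.
move=> [n _ Hn]; exists n.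
by apply: le_ereal_inf_tmp => _ [y Ky <-]; apply/ltW/(Hn n (leqnn n)).
Qed.

End lower_semicontinuity.

(** * Bellman operator, value iteration and measurable selection *)

Section value_iteration.
Context (R : realType) d (X : measurableType d) (Q : probability X R).
Variables (rho : X -> R) (Psi : R -> R -> X -> R) (cost : R -> R).
Hypothesis mrho : measurable_fun setT rho.
Hypothesis rho0 : forall x, 0 <= rho x.
Hypothesis mPsi : forall z b, measurable_fun setT (Psi z b).
Hypothesis cPsi : forall x, continuous (fun p : R * R => Psi p.1 p.2 x).
Hypothesis cost0 : forall z, 0 <= cost z.
(** Stronger than lower semicontinuity, and true for the indicator of an open half-line. *)
Hypothesis cost_lsc : forall z, \forall y \near z, cost z <= cost y.
Local Open Scope ereal_scope.

Record admissible_value (u : R -> \bar R) : Prop := {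
  av_ge0 : forall z, 0 <= u z ;
  av_lsc : lsc u }.

Definition continuation (u : R -> \bar R) (z b : R) : \bar R :=
  \int[Q]_x ((rho x)%:E * u (Psi z b x)).

Definition bellman (u : R -> \bar R) (z : R) : \bar R :=
  (cost z)%:E + ereal_inf [set continuation u z b | b in `[0%R, 1%R]%classic].

Lemma continuation_ge0 u z b : admissible_value u -> 0 <= continuation u z b.
Proof.
by move=> au; apply: integral_ge0 => x _; rewrite mule_ge0 ?lee_fin// av_ge0.
Qed.

Lemma measurable_continuation_integrand u z b : admissible_value u ->
  measurable_fun setT (fun x => (rho x)%:E * u (Psi z b x)).
Proof.
move=> au; apply: emeasurable_funM; first exact/measurable_EFinP.
exact: measurableT_comp (lsc_measurable (av_lsc au)) (mPsi z b).
Qed.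

Lemma le_continuation_u u v z b : admissible_value u -> admissible_value v ->
  (forall z, u z <= v z) -> continuation u z b <= continuation v z b.
Proof.
move=> au av uv; apply: ge0_le_integral => //.
- by move=> x _; rewrite mule_ge0 ?lee_fin// av_ge0.
- exact: measurable_continuation_integrand.
- exact: measurable_continuation_integrand.
- by move=> x _; rewrite lee_wpmul2l// lee_fin.
Qed.

(** Continuity of [Psi] in state and control makes the integrand lower semicontinuous for each fixed
    x; Fatou's lemma along a convergent sequence does the rest. *)
Lemma continuation_lsc u : admissible_value u ->
  lsc (fun p : R * R => continuation u p.1 p.2).
Proof.
move=> au; apply: (@seq_lsc R) => p_ p cp.
have h0 n x : 0 <= (rho x)%:E * u (Psi (p_ n).1 (p_ n).2 x).
  by rewrite mule_ge0 ?lee_fin// av_ge0.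
have mh n : measurable_fun setT (fun x => (rho x)%:E * u (Psi (p_ n).1 (p_ n).2 x)).
  exact: measurable_continuation_integrand.
apply: le_trans (fatou Q measurableT mh (fun n x _ => h0 n x)).
apply: ge0_le_integral => //.
- by move=> x _; rewrite mule_ge0 ?lee_fin// av_ge0.
- exact: measurable_continuation_integrand.
- rewrite (_ : (fun _ => _) = (fun x =>
      - limn_esup (fun n => - ((rho x)%:E * u (Psi (p_ n).1 (p_ n).2 x))))).
    apply: measurableT_comp => //.
    apply: (measurable_fun_limn_esup
      (f := fun n x => - ((rho x)%:E * u (Psi (p_ n).1 (p_ n).2 x)))).
    by move=> n; exact: measurableT_comp.
  by apply/funext => x.
- move=> x _.
  apply: (@lsc_limn_einf R _ (fun q : R * R => (rho x)%:E * u (Psi q.1 q.2 x))) cp.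
  (* If [rho x] is 0 the product vanishes even where [u] is infinite; otherwise the inequality is
     divided by [rho x]. *)
  move=> q a; have := rho0 x; rewrite le_eqVlt => /predU1P[<-|r0].
    by rewrite mul0e => a0; near=> y; rewrite mul0e.
  rewrite -lte_pdivrMl// -EFinM => /(av_lsc au) H.
  have {}H : \forall y \near q, ((rho x)^-1 * a)%:E < u (Psi y.1 y.2 x) := @cPsi x q _ H.
  by near=> y; rewrite -lte_pdivrMl// -EFinM; near: y.
Unshelve. all: by end_near. Qed.

Lemma bellman_admissible u : admissible_value u -> admissible_value (bellman u).
Proof.
move=> au; have inf0 z : 0 <= ereal_inf [set continuation u z b | b in `[0%R, 1%R]%classic].
  by apply: le_ereal_inf_tmp => _ [b _ <-]; exact: continuation_ge0.
split.
- by move=> z; rewrite adde_ge0// lee_fin.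
- move=> z a az.
  have li := lsc_inf_compact (@segment_compact R 0 1) (continuation_lsc au).
  have : (a - cost z)%:E < ereal_inf [set continuation u z b | b in `[0%R, 1%R]%classic].
    by rewrite EFinB lteBlDr// addeC.
  move=> /(li z) H; have cz := cost_lsc z.
  near=> y; have h1 : (cost z <= cost y)%R by near: y.
  have : (a - cost z)%:E < ereal_inf [set continuation u y b | b in `[0%R, 1%R]%classic].
    by near: y.
  rewrite EFinB lteBlDr// addeC => /lt_le_trans; apply.
  by rewrite /bellman leeD2r// lee_fin.
Unshelve. all: by end_near. Qed.

Fixpoint value_iter (n : nat) : R -> \bar R :=
  if n is n'.+1 then bellman (value_iter n') else cst 0.

Lemma value_iter_admissible n : admissible_value (value_iter n).
Proof.
elim: n => [|n IH]; last exact: bellman_admissible.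
by split => // z a /= a0; near=> y.
Unshelve. all: by end_near. Qed.

Lemma le_bellman u v z : admissible_value u -> admissible_value v ->
  (forall z, u z <= v z) -> bellman u z <= bellman v z.
Proof.
move=> au av uv; apply: leeD => //.
apply: le_ereal_inf_tmp => _ [b b01 <-].
apply: le_trans (le_continuation_u z b au av uv).
by apply: ereal_inf_lbound; exists b.
Qed.

Lemma value_iter_nd z : nondecreasing_seq (value_iter ^~ z).
Proof.
apply/nondecreasing_seqP => n; elim: n z => [|n IH] z.
  exact: (av_ge0 (value_iter_admissible 1)).
exact: (le_bellman z (value_iter_admissible n) (value_iter_admissible n.+1) IH).
Qed.

Definition value_limit (z : R) : \bar R := ereal_sup (range (value_iter ^~ z)).

Lemma value_iter_le_limit n z : value_iter n z <= value_limit z.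
Proof. by apply: ereal_sup_ubound; exists n. Qed.

Lemma value_limit_gt z a : a < value_limit z -> exists n, a < value_iter n z.
Proof. by move=> /ereal_sup_gt[_ [n _ <-] an]; exists n. Qed.

Lemma value_limit_admissible : admissible_value value_limit.
Proof.
split.
- move=> z; apply: le_trans (value_iter_le_limit 0 z).
  exact: (av_ge0 (value_iter_admissible 0)).
- move=> z a /value_limit_gt[n /(av_lsc (value_iter_admissible n))].
  by apply: filterS => y /lt_le_trans; apply; exact: value_iter_le_limit.
Qed.

Lemma continuation_limit_gt z b a : a < continuation value_limit z b ->
  exists n, a < continuation (value_iter n) z b.
Proof.
move=> aF; pose g n x := (rho x)%:E * value_iter n (Psi z b x).
have gnd x : nondecreasing_seq (g ^~ x).
  move=> m n mn; rewrite lee_wpmul2l ?lee_fin//; exact: value_iter_nd.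
have mg n : measurable_fun setT (g n).
  exact: measurable_continuation_integrand (value_iter_admissible n).
have g0 n x : 0 <= g n x.
  by rewrite mule_ge0 ?lee_fin//; exact: (av_ge0 (value_iter_admissible n)).
have := @cvg_monotone_convergence _ _ _ Q _ measurableT g mg (fun n x _ => g0 n x)
  (fun x _ => gnd x).
rewrite (_ : \int[Q]_x _ = continuation value_limit z b); last first.
  apply: eq_integral => x _; apply/cvg_lim => //; apply: cvgeZl => //.
  apply: ereal_nondecreasing_cvgn; exact: value_iter_nd.
move=> cF; apply: contrapT => /forallNP H.
have : continuation value_limit z b <= a.
  apply: cvge_le cF; apply: nearW => n.
  by rewrite leNgt; apply/negP/H.
by rewrite leNgt aF.
Qed.

(** This is the exchange of infimum and increasing limit. A real a strictly between the two sides
    would, by [inf_sup_compact], be at most some iterate, while it exceeds the limit of all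
    iterates. *)
Lemma bellman_limit_le z : bellman value_limit z <= value_limit z.
Proof.
rewrite leNgt; apply/negP => /ereal_lt_dense_real[a /andP[va ab]].
have aI : (a - cost z)%:E <
    ereal_inf [set continuation value_limit z b | b in `[0%R, 1%R]%classic].
  by rewrite EFinB lteBlDr// addeC.
have [||| n] := @inf_sup_compact R _ _ (fun n b => continuation (value_iter n) z b)
  (continuation value_limit z) _ (@segment_compact R 0 1) _ _ _ aI.
- move=> n; apply: (@lsc_pair_right R _ _ (continuation (value_iter n)) z).
  exact: continuation_lsc (value_iter_admissible n).
- move=> b m n mn; apply: le_continuation_u; try exact: value_iter_admissible.
  by move=> y; exact: value_iter_nd.
- by move=> b c _; exact: continuation_limit_gt.
rewrite EFinB leeBlDr// addeC => an.
have := le_lt_trans (le_trans an (value_iter_le_limit n.+1 z)) va.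
by rewrite ltxx.
Qed.

(* The least minimiser b is measurable because {b > c} is the set where the
   minimum over [0, 1] is smaller than the minimum over [0, c], and both minima
   are lower semicontinuous in z. *)
Lemma exists_selector u : admissible_value u -> exists b : R -> R,
  [/\ measurable_fun setT b, forall z, b z \in `[0%R, 1%R] &
   forall z, continuation u z (b z) =
     ereal_inf [set continuation u z b | b in `[0%R, 1%R]%classic]].
Proof.
move=> au.
pose I (c z : R) := ereal_inf [set continuation u z b | b in `[0%R, c]%classic].
have Ilsc c : lsc (I c).
  exact: lsc_inf_compact (@segment_compact R 0 c) (continuation_lsc au).
have mI c : measurable_fun setT (I c) by exact: lsc_measurable.
have att c z : (0 <= c)%R -> exists2 b, b \in `[0%R, c] & continuation u z b = I c z.
  move=> c0; have [||b bc bE] := @lsc_compact_min R _ `[0%R, c]%classic (continuation u z)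
    (@segment_compact R 0 c) _ _ (lsc_pair_right (x := z) (continuation_lsc au)).
  - by exists 0%R; rewrite /= in_itv/= lexx.
  - by move=> y; exact: continuation_ge0.
  by exists b.
pose A z := [set b | b \in `[0%R, 1%R] /\ continuation u z b = I 1%R z].
have A0 z : A z !=set0 by have [b b01 bE] := att 1%R z ler01; exists b.
have lbA z : lbound (A z) 0%R by move=> b [+ _]; rewrite in_itv/= => /andP[].
have hA z : has_inf (A z) by split; [exact: A0|exists 0%R; exact: lbA].
pose b z := inf (A z).
have b01 z : b z \in `[0%R, 1%R].
  rewrite in_itv/= lb_le_inf//=; have [c Ac] := A0 z.
  apply: (@le_trans _ _ c); first by apply: ge_inf => //; exact: (hA z).2.
  by case: Ac; rewrite in_itv/= => /andP[].
(* The infimum of the minimisers is itself one: otherwise, by lower semicontinuity, the continuation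
   value would exceed some a above the minimum near [b z], where there are minimisers. *)
have bA z : continuation u z (b z) = I 1%R z.
  apply/eqP; rewrite eq_le; apply/andP; split; last first.
    by apply: ereal_inf_lbound; exists (b z) => //; exact: b01.
  rewrite leNgt; apply/negP => /ereal_lt_dense_real[a /andP[Ia ab]].
  have /nbhs_ballP[e /= e0 He] := lsc_pair_right (x := z) (continuation_lsc au) ab.
  have [c Ac cb] := inf_adherent e0 (hA z).
  have bc : (b z <= c)%R by apply: ge_inf => //; exact: (hA z).2.
  have : a%:E < continuation u z c.
    apply: He; rewrite /ball/= distrC ger0_norm ?subr_ge0//.
    by rewrite ltrBlDl.
  by rewrite Ac.2 ltNge (ltW Ia).
exists b; split => //.
apply: (measurability _ (RGenOInfty.measurableE R)) => _ [_ [c ->] <-].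
rewrite setTI; have [c0|c0] := ltP c 0%R.
  rewrite (_ : _ @^-1` _ = setT)//; apply/seteqP; split => z //= _.
  rewrite in_itv/= andbT (lt_le_trans c0)//.
  by have := b01 z; rewrite in_itv/= => /andP[].
have [c1|c1] := leP 1%R c.
  rewrite (_ : _ @^-1` _ = set0)//; apply/seteqP; split => z //=.
  have := b01 z; rewrite !in_itv/= andbT => /andP[_ b1] cb.
  by have := lt_le_trans cb (le_trans b1 c1); rewrite ltxx.
rewrite (_ : _ @^-1` _ = [set z | I 1%R z < I c z]).
  rewrite -[X in measurable X]setTI; exact: measurable_lte.
apply/seteqP; split => z /=; rewrite in_itv/= andbT => H.
  rewrite ltNge; apply/negP => Icz; have [e ec eE] := att c z c0.
  move: H; apply/negP; rewrite -leNgt; move: (ec); rewrite in_itv/= => /andP[e0 ec'].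
  apply: le_trans (ec'); apply: ge_inf; first exact: (hA z).2.
  have e01 : e \in `[0%R, 1%R] by rewrite in_itv/= e0 (le_trans ec' (ltW c1)).
  split => //; apply/eqP; rewrite eq_le eE Icz/=.
  by rewrite -eE; apply: ereal_inf_lbound; exists e.
rewrite ltNge; apply/negP => bc; move: H; apply/negP; rewrite -leNgt -bA.
apply: ereal_inf_lbound; exists (b z) => //=.
by rewrite in_itv/= bc andbT; have := b01 z; rewrite in_itv/= => /andP[].
Qed.

End value_iteration.

(** * The drawdown at the arrival times *)

Lemma has_sup_addl (R : realType) (A : set R) (c : R) : has_sup A -> has_sup [set c + y | y in A].
Proof.
move=> [[a Aa] [M AM]]; split; first by exists (c + a), a.
by exists (c + M) => _ [y Ay <-]; rewrite lerD2l; exact: AM.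
Qed.

Lemma sup_addl (R : realType) (A : set R) (c : R) : has_sup A -> sup [set c + y | y in A] = c + sup A.
Proof.
move=> sA; have sA' := has_sup_addl c sA; apply/eqP; rewrite eq_le; apply/andP; split.
  apply: ge_sup sA'.1 _ => _ [y Ay <-]; rewrite lerD2l.
  by apply: ub_le_sup => //; exact: sA.2.
rewrite -lerBrDl; apply: ge_sup sA.1 _ => y Ay; rewrite lerBrDl.
by apply: ub_le_sup; [exact: sA'.2|exists y].
Qed.

Lemma sup_setU_max (R : realType) (A C : set R) : has_sup A -> has_sup C ->
  sup (A `|` C) = Num.max (sup A) (sup C).
Proof.
move=> [[a Aa] uA] [[c Cc] uC]; have uAC : has_ubound (A `|` C).
  case: uA uC => M MA [M' MC]; exists (Num.max M M').
  by move=> y [/MA|/MC] yM; rewrite le_max yM ?orbT.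
apply/eqP; rewrite eq_le; apply/andP; split.
  apply: ge_sup; first by exists a; left.
  by move=> y [Ay|Cy]; rewrite le_max; apply/orP; [left|right]; exact: ub_le_sup.
rewrite ge_max; apply/andP; split; apply: ge_sup.
- by exists a.
- by move=> y Ay; apply: ub_le_sup => //; left.
- by exists c.
- by move=> y Cy; apply: ub_le_sup => //; right.
Qed.

Section drawdown_recursion.
Context d (Omega : measurableType d) (R : realType) (P : probability Omega R).
Variables (W : R -> Omega -> R) (N : R -> Omega -> nat) (T : nat -> Omega -> R).
Variables eta theta sigma : R.
Hypothesis hW : standard_brownian_motion P W.
Hypothesis hN : renewal_process P N T.
Variables (b : nat -> Omega -> R) (w : Omega).
Hypothesis b01 : forall k, 0 <= b k w <= 1.

Let B := fun t w => b (N t w) w.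
Let S := surplus W N T eta theta sigma B ^~ w.

Lemma countE k t : T k w <= t < T k.+1 w -> N t w = k.
Proof.
move=> /andP[kt tk]; have t0 := le_trans (arrival_ge0 hN k w) kt.
apply/eqP; rewrite eqn_leq (rp_count hN)// kt andbT.
by rewrite leqNgt (rp_count hN)// -ltNge.
Qed.

Lemma measurable_count_time t : measurable_fun (`[0, t] : set R) (N ^~ w).
Proof.
move=> mD; apply: (measurability _ NGenCInfty.measurableE) => // _ [_ [k ->] <-].
rewrite (_ : _ `&` _ = `[0, t] `&` `[T k w, +oo[)%classic; first exact: measurableI.
apply/seteqP; split => s /= [s0t]; rewrite !in_itv/= !andbT leEnat;
  move: (s0t); rewrite in_itv/= => /andP[s0 _]; by rewrite (rp_count hN).
Qed.

Lemma drift_integrable t :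
  lebesgue_measure.-integrable `[0, t]
    (EFin \o (fun s => drift eta theta (B s w))).
Proof.
apply: measurable_bounded_integrable => //.
- by rewrite [ltLHS](lebesgue_measure_itv `[0, t])/=; case: ifP => _; rewrite ltry.
- apply: (measurableT_comp (f := fun n => drift eta theta (b n w))) => //.
  exact: measurable_count_time.
exists (`|eta| + `|theta|); split => [|M MM s _]; first exact: num_real.
apply: le_trans (ltW MM); rewrite /drift /B.
apply: (le_trans (ler_normB _ _)); rewrite lerD2l normrM ler_piMl//.
by have /andP[? ?] := b01 (N s w); rewrite ger0_norm ?subr_ge0// lerBlDr lerDl.
Qed.

Lemma drift_integral k t : T k w <= t <= T k.+1 w ->
  \int[lebesgue_measure]_(s in `[0, t]) drift eta theta (B s w) =
  \int[lebesgue_measure]_(s in `[0, T k w]) drift eta theta (B s w) +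
  drift eta theta (b k w) * (t - T k w).
Proof.
move=> /andP[kt tk]; apply/eqP; rewrite addrC -subr_eq; apply/eqP.
have Tk0 := arrival_ge0 hN k w.
rewrite (Rintegral_itvB (drift_integrable t)) ?bnd_simp//.
(* The right end point is removed because at t = T k.+1 the control has already jumped. *)
rewrite -Rintegral_itv_bndo_bndc; last first.
  apply: integrableS (drift_integrable t) => //.
  by move=> s /=; rewrite !in_itv/= => /andP[ks st]; rewrite (le_trans Tk0 (ltW ks)) ltW.
rewrite (@eq_Rintegral _ _ _ lebesgue_measure _ (cst (drift eta theta (b k w)))); last first.
  move=> s; rewrite inE/= in_itv/= => /andP[ks st].
  by rewrite /B (@countE k)// (ltW ks) (lt_le_trans st tk).
rewrite Rintegral_cst// [X in fine X](lebesgue_measure_itv `]T k w, t[)/= lte_fin.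
by move: kt; rewrite le_eqVlt => /predU1P[<-|->//]; rewrite ltxx subrr.
Qed.

Lemma stochastic_integral_step k t : T k w <= t <= T k.+1 w ->
  stochastic_integral W N T (fun s w => volatility sigma (B s w)) t w =
  \sum_(i < k) volatility sigma (b i w) * (W (T i.+1 w) w - W (T i w) w) +
  volatility sigma (b k w) * (W t w - W (T k w) w).
Proof.
move=> /andP[kt tk]; rewrite /stochastic_integral.
have HE i : B (T i w) w = b i w by rewrite /B (count_arrival hN).
have sumE m : (m <= k)%N -> \sum_(i < m) volatility sigma (B (T i w) w) *
     (W (Num.min t (T i.+1 w)) w - W (T i w) w) =
   \sum_(i < m) volatility sigma (b i w) * (W (T i.+1 w) w - W (T i w) w).
  move=> mk; apply: eq_bigr => i _; rewrite HE min_r//.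
  apply: le_trans kt; apply: (arrival_mono hN).
  exact: leq_trans (ltn_ord i) mk.
(* At t = T k.+1 the count is already k + 1 and the sum has one more term, whose Brownian increment
   is 0. *)
move: tk; rewrite le_eqVlt => /predU1P[tE|tk].
  rewrite tE (count_arrival hN) !big_ord_recr/= -[in LHS]tE sumE//.
  by rewrite tE !HE minxx min_l ?subrr ?mulr0 ?addr0// ltW// (rp_increasing hN).
by rewrite (@countE k) ?kt ?tk// big_ord_recr/= sumE// HE min_l// ltW.
Qed.

Lemma surplus_step k t : T k w <= t <= T k.+1 w ->
  S t = S (T k w) + (drift eta theta (b k w) * (t - T k w) +
    volatility sigma (b k w) * (W t w - W (T k w) w)).
Proof.
move=> ktk; rewrite /S/= /surplus (drift_integral ktk) (stochastic_integral_step ktk).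
have kk : T k w <= T k w <= T k.+1 w by rewrite lexx ltW// (rp_increasing hN).
by rewrite (stochastic_integral_step kk) subrr mulr0 addr0 addrACA.
Qed.

Lemma surplus_segment k s : 0 <= s <= interarrival T k w ->
  S (T k w + s) = S (T k w) + segment eta theta sigma (b k w) (post_path W T k w) s.
Proof.
move=> /andP[s0 s1]; rewrite (@surplus_step k) ?lerDl ?s0//; last first.
  by rewrite addrC -lerBrDr.
rewrite /segment /post_path (shifted_pathE (@bm_continuous _ _ _ _ _ hW)) ?(arrival_ge0 hN)//.
by rewrite (ger0_norm s0) [T k w + s - _]addrAC subrr add0r.
Qed.

Lemma surplus0 : S 0 = 0.
Proof.
have k0 : T 0 w <= 0 <= T 1 w by rewrite (rp_start hN) lexx (arrival_ge0 hN).
rewrite /S/= /surplus (stochastic_integral_step k0) (rp_start hN) subrr mulr0 addr0.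
by rewrite big_ord0 addr0 set_itv1 Rintegral_set1.
Qed.

Let range_S t := [set S s | s in `[0, t]%classic].

Lemma segment_range k (x := step_data W T k w) :
  [set S s | s in `[T k w, T k.+1 w]%classic] =
  [set S (T k w) + y | y in
     [set segment eta theta sigma (b k w) x.2 (s * x.1) | s in `[0, 1]%classic]].
Proof.
have tau0 := interarrival_gt0 hN k w.
apply/seteqP; split => [v [s /=]|v [y [s /= s01 <-] <-]].
  rewrite in_itv/= => /andP[ks sk] <-.
  exists (segment eta theta sigma (b k w) x.2 (s - T k w)).
    exists ((s - T k w) / interarrival T k w).
      have sT : 0 <= s - T k w by rewrite subr_ge0.
      by rewrite /= in_itv/= (divr_ge0 sT (ltW tau0))/= ler_pdivrMr// mul1r lerD2r.
    by rewrite /= divfK// gt_eqF.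
  rewrite -surplus_segment ?subr_ge0 ?ks ?lerD2r//.
  by rewrite addrC subrK.
move: s01; rewrite in_itv/= => /andP[s0 s1].
have h : 0 <= s * interarrival T k w <= interarrival T k w.
  by rewrite mulr_ge0 ?(ltW tau0)//= ler_piMl// ltW.
exists (T k w + s * interarrival T k w); last exact: surplus_segment.
rewrite /= in_itv/=; case/andP: h => h1 h2; rewrite lerDl h1/=.
by rewrite addrC -lerBrDr.
Qed.

Lemma range_S_split k : range_S (T k.+1 w) =
  range_S (T k w) `|` [set S s | s in `[T k w, T k.+1 w]%classic].
Proof.
rewrite /range_S -image_setU; congr (_ @` _).
have T0 := arrival_ge0 hN k w.
have T1 := ltW (rp_increasing hN k w).
apply/seteqP; split => s /=; rewrite !in_itv/=.
  by move=> /andP[s0 s1]; have [sk|sk] := leP s (T k w);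
    [left; rewrite s0|right; rewrite s1 ltW].
move=> [/andP[s0 s1]|/andP[s0 s1]]; first by rewrite s0 (le_trans s1).
by rewrite s1 (le_trans T0).
Qed.

Lemma range_S_has_sup k : has_sup (range_S (T k w)).
Proof.
elim: k => [|k [ne ub]].
  rewrite (rp_start hN) /range_S set_itv1 image_set1.
  by split; [exists (S 0)|exists (S 0) => _ ->].
rewrite range_S_split segment_range.
have [ne' ub'] := has_sup_addl (S (T k w))
  (segment_has_sup eta theta sigma (b k w) (step_data W T k w)).
split; first by case: ne => y Sy; exists y; left.
case: ub => M MS; case: ub' => M' MS'; exists (Num.max M M').
by move=> y [/MS|/MS'] yM; rewrite le_max yM ?orbT.
Qed.

(** Split the running supremum at T_k and subtract the surplus at T_k inside the maximum: the
    maximum of z and the earlier supremum becomes the drawdown at T_k, and the later supremum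
    becomes [segment_sup]. *)
Lemma drawdown_stepE z k :
  drawdown W N T eta theta sigma B z (T k.+1 w) w =
  drawdown_step eta theta sigma (drawdown W N T eta theta sigma B z (T k w) w)
    (b k w) (step_data W T k w).
Proof.
rewrite /drawdown /drawdown_step.
have E : sup [set surplus W N T eta theta sigma B s w | s in `[0, T k.+1 w]%classic] =
  Num.max (sup (range_S (T k w)))
    (S (T k w) + segment_sup eta theta sigma (b k w) (step_data W T k w)).
  have := range_S_split k; rewrite /range_S => ->; rewrite segment_range.
  rewrite sup_setU_max; first by rewrite sup_addl//; exact: segment_has_sup.
    exact: range_S_has_sup.
  by apply: has_sup_addl; exact: segment_has_sup.
rewrite E -/(S (T k.+1 w)) -/(S (T k w)) -/(range_S _).
have tk : T k.+1 w = T k w + interarrival T k w by rewrite addrC subrK.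
have -> : S (T k.+1 w) = S (T k w) +
    segment eta theta sigma (b k w) (post_path W T k w) (interarrival T k w).
  by rewrite tk surplus_segment// (ltW (interarrival_gt0 hN k w)) lexx.
rewrite /= -/(segment_sup _ _ _ _ _).
set y := S (T k w); set sg := segment _ _ _ _ _ _.
set ss := segment_sup _ _ _ _ _; set sr := sup _.
have maxB (c e : R) : Num.max c e - y = Num.max (c - y) (e - y) by rewrite addr_maxl.
rewrite opprD addrA; congr (_ - _).
have e1 : y + ss - y = ss by rewrite addrAC subrr add0r.
by rewrite maxA [LHS]maxB e1.
Qed.

Lemma drawdown_start z : drawdown W N T eta theta sigma B z 0 w = Num.max z 0.
Proof.
rewrite /drawdown -/(S 0) surplus0 subr0.
rewrite (_ : [set _ | _ in _] = range_S 0)// /range_S set_itv1 image_set1 sup1.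
by rewrite surplus0.
Qed.

End drawdown_recursion.

(** * Measurability with respect to the past of an arrival time *)

Section stopped_measurability.
Context d (Omega : measurableType d) (R : realType) (P : probability Omega R).
Variables (W : R -> Omega -> R) (N : R -> Omega -> nat) (T : nat -> Omega -> R).
Hypothesis hW : standard_brownian_motion P W.
Hypothesis hN : renewal_process P N T.

Notation F := (filtration W N).
Notation G k := (stopped_sigma_algebra W N (T k)).
Notation stoppedType k := (g_sigma_algebraType (stopped_sigma_algebra W N (T k))).

Lemma filtration_sigma_algebra t : 0 <= t -> sigma_algebra setT (F t).
Proof. by move=> t0; have [] := filtration_right_continuous W N t0. Qed.

Lemma filtration_mono s t : s <= t -> F s `<=` F t.
Proof.
move=> st A FA u; rewrite /= in_itv/= andbT => tu.
by apply: FA; rewrite /= in_itv/= andbT (le_lt_trans st).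
Qed.

Lemma filtration_measurable t : F t `<=` measurable.
Proof.
have t1 : t < t + 1 by rewrite ltrDl.
apply: subset_trans (filtration_sub t1) _.
apply: smallest_sub; first exact: sigma_algebra_measurable.
move=> A [].
  apply: (sigma_brownian_measurable hW) => s /=.
  by rewrite in_itv/= => /andP[].
apply: (sigma_count_measurable hN) => s /=.
by rewrite in_itv/= => /andP[].
Qed.

Lemma filtrationE t : 0 <= t -> (F t).-sigma.-measurable = F t.
Proof.
by move=> t0; apply: measurable_g_measurableTypeE; exact: filtration_sigma_algebra.
Qed.

Lemma filtration_arrival k t : 0 <= t -> F t [set w | T k w <= t].
Proof.
move=> t0; have [_ /(_ t t0)] := stopped_sigma_algebraT W hN k.
by rewrite setTI.
Qed.

Lemma stopped_sigma_algebraP k : sigma_algebra setT (G k).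
Proof.
have E t (A : set Omega) : 0 <= t -> F t A -> (F t).-sigma.-measurable A.
  by move=> t0; rewrite filtrationE.
split.
- split=> // t t0; rewrite set0I; by have [] := filtration_sigma_algebra t0.
- move=> A [mA FA]; split; first by rewrite setTD; exact: measurableC.
  move=> t t0; rewrite (_ : _ `&` _ =
    [set w | T k w <= t] `\` (A `&` [set w | T k w <= t])).
    rewrite -filtrationE//; apply: measurableD; apply: E => //.
      exact: filtration_arrival.
    exact: FA.
  by apply/seteqP; split => w [h1 h2]; split => //;
    [case=> Aw _; case: h1 => _; exact|split => // Aw; exact: h2].
- move=> A GA; split; first by apply: bigcupT_measurable => i; have [] := GA i.
  move=> t t0; rewrite setI_bigcupl -filtrationE//.
  apply: bigcupT_measurable => i; rewrite filtrationE//.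
  by have [_] := GA i; exact.
Qed.

Lemma stopped_typeE k : (G k).-sigma.-measurable = G k.
Proof. exact: measurable_g_measurableTypeE (stopped_sigma_algebraP k). Qed.

Lemma stopped_measurable k : G k `<=` measurable.
Proof. by move=> A []. Qed.

Lemma stopped_mono k : G k `<=` G k.+1.
Proof.
move=> A [mA FA]; split => // t t0.
rewrite (_ : _ `&` _ = (A `&` [set w | T k w <= t]) `&` [set w | T k.+1 w <= t]).
  rewrite -filtrationE//; apply: measurableI; rewrite filtrationE//; first exact: FA.
  exact: filtration_arrival.
apply/seteqP; split => w [h1 h2]; split => //; last by case: h1.
by split => //=; apply: le_trans h2; rewrite ltW// (rp_increasing hN).
Qed.

Lemma measurable_fun_stoppedS k d' (U : measurableType d') (f : Omega -> U) :
  measurable_fun [set: stoppedType k] f -> measurable_fun [set: stoppedType k.+1] f.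
Proof.
move=> mf _ B mB; rewrite stopped_typeE; apply: stopped_mono.
by rewrite -stopped_typeE; exact: mf.
Qed.

Lemma measurable_fun_stoppedP k (f : Omega -> R) :
  measurable_fun [set: stoppedType k] f <->
  preimage_set_system setT f measurable `<=` G k.
Proof.
split => [mf _ [B mB <-]|fG _ B mB]; first by rewrite -stopped_typeE; exact: mf.
by rewrite stopped_typeE; apply: fG; exists B.
Qed.

Lemma filtration_brownian u t : 0 <= u <= t ->
  measurable_fun [set: g_sigma_algebraType (F t)] (W u).
Proof.
move=> /andP[u0 ut] _ B mB; rewrite filtrationE ?(le_trans u0)//.
apply: (filtration_mono ut); apply: (filtration_adaptedW (N := N) u0).
by exists B.
Qed.

Lemma min_stopping_time (f : Omega -> R) t : 0 <= t ->
  (forall u, 0 <= u -> F u [set w | f w <= u]) -> (forall w, 0 <= f w) ->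
  measurable_fun [set: g_sigma_algebraType (F t)] (fun w => Num.min (f w) t).
Proof.
move=> t0 sf f0.
apply: (measurability _ (RGenOInfty.measurableE R)) => _ [_ [x ->] <-].
rewrite setTI; have [x0|x0] := ltP x 0.
  rewrite (_ : _ @^-1` _ = setT)//; apply/seteqP; split => w //= _.
  by rewrite in_itv/= andbT lt_min (lt_le_trans x0)//= (lt_le_trans x0).
have [tx|xt] := leP t x.
  rewrite (_ : _ @^-1` _ = set0)//; apply/seteqP; split => w //=.
  by rewrite in_itv/= andbT lt_min => /andP[_ /lt_le_trans/(_ tx)]; rewrite ltxx.
rewrite (_ : _ @^-1` _ = ~` [set w | f w <= x]).
  apply: measurableC; rewrite filtrationE//.
  by apply: (filtration_mono (ltW xt)); exact: sf.
apply/seteqP; split => w /=; rewrite in_itv/= andbT lt_min.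
  by move=> /andP[xf _]; apply/negP; rewrite -ltNge.
by move=> /negP; rewrite -ltNge => ->.
Qed.

(** On {T_k <= t} the time f equals min (f, t), and W at that time depends on W only up to t. *)
Lemma stopped_brownian k (f : Omega -> R) :
  (forall u, 0 <= u -> F u [set w | f w <= u]) -> (forall w, 0 <= f w <= T k w) ->
  measurable_fun [set: stoppedType k] (fun w => W (f w) w).
Proof.
move=> sf fT; have f0 w : 0 <= f w by case/andP: (fT w).
have key t : 0 <= t ->
    measurable_fun [set: g_sigma_algebraType (F t)] (fun w => W (Num.min (f w) t) w).
  move=> t0.
  (* The process s -> W (min (|s|, t)) is continuous on the whole line and each of its values is
     known at time t, so it can be evaluated at a random time within the filtration at t. *)
  rewrite (_ : (fun _ => _) = (fun w => W (Num.min `|Num.min (f w) t| t) w)); last first.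
    apply/funext => w; congr (W _ w).
    by rewrite (@ger0_norm _ (Num.min _ _)) ?le_min ?f0// -minA minxx.
  apply: (@measurable_continuous_process _ (g_sigma_algebraType (F t)) R
    (fun w s => W (Num.min `|s| t) w) (fun w => Num.min (f w) t)).
  - move=> w.
    have cm : continuous (fun s : R => Num.min `|s| t).
      move=> s; apply: (@continuous_min _ _ (fun s : R => `|s| : R^o) (fun=> t : R^o)).
        exact: norm_continuous.
      exact: cvg_cst.
    apply: (@continuous_comp_within R (W ^~ w) _ _ (@bm_continuous _ _ _ _ _ hW w) cm).
    by move=> s; rewrite /= in_itv/= andbT le_min normr_ge0.
  - by move=> s; apply: filtration_brownian; rewrite le_min normr_ge0 t0 ge_min lexx orbT.
  - exact: min_stopping_time.
move=> _ B mB; rewrite setTI stopped_typeE; split.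
  rewrite -[X in measurable X]setTI; apply: (measurable_brownian_at hW) => //.
  apply: (measurability _ (RGenOInfty.measurableE R)) => _ [_ [x ->] <-].
  rewrite setTI; have [x0|x0] := ltP x 0.
    rewrite (_ : _ @^-1` _ = setT)//; apply/seteqP; split => w //= _.
    by rewrite in_itv/= andbT (lt_le_trans x0).
  rewrite (_ : _ @^-1` _ = ~` [set w | f w <= x]).
    by apply: measurableC; exact: filtration_measurable (sf _ x0).
  apply/seteqP; split => w /=; rewrite in_itv/= andbT.
    by move=> xf; apply/negP; rewrite -ltNge.
  by move=> /negP; rewrite -ltNge.
move=> t t0; rewrite (_ : _ `&` _ =
   ((fun w => W (Num.min (f w) t) w) @^-1` B) `&` [set w | T k w <= t]).
  rewrite -filtrationE//; apply: measurableI.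
    by rewrite -[X in measurable X]setTI; exact: key.
  by rewrite filtrationE//; exact: filtration_arrival.
by apply/seteqP; split => w /= [Bw Tw]; split => //; move: Bw; rewrite min_l//;
  apply: le_trans Tw; case/andP: (fT w).
Qed.

Lemma stopped_arrival k : measurable_fun [set: stoppedType k] (T k).
Proof.
apply/measurable_fun_stoppedP => _ [B mB <-]; rewrite setTI; split.
  by rewrite -[X in measurable X]setTI; exact: (measurable_arrival hN).
move=> t t0.
rewrite (_ : _ `&` _ = ((fun w => Num.min (T k w) t) @^-1` B) `&` [set w | T k w <= t]).
  rewrite -filtrationE//; apply: measurableI; last first.
    by rewrite filtrationE//; exact: filtration_arrival.
  rewrite -[X in measurable X]setTI; apply: min_stopping_time => //.
    by move=> u u0; exact: filtration_arrival.
  exact: (arrival_ge0 hN).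
by apply/seteqP; split => w /= [Bw Tw]; split => //; move: Bw; rewrite min_l.
Qed.

(* The increments of W after T_k, frozen at T_(k+1): unlike [post_path], this
   path is known at time T_(k+1). *)
Definition stopped_path (k : nat) (w : Omega) : cpathType R :=
  mk_cpath (fun s => W (Num.min (T k w + `|s|) (T k.+1 w)) w - W (T k w) w).

Lemma stopped_pathE k w : (stopped_path k w : cpath R) =
  (fun s => W (Num.min (T k w + `|s|) (T k.+1 w)) w - W (T k w) w) :> (R -> R).
Proof.
rewrite mk_cpathE//.
have cm : continuous (fun s : R => Num.min (T k w + `|s|) (T k.+1 w)).
  move=> s; apply: (@continuous_min _ _ (fun s : R => T k w + `|s| : R^o) (fun=> T k.+1 w : R^o)).
    by apply: cvgD; [exact: cvg_cst|exact: norm_continuous].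
  exact: cvg_cst.
have cc : continuous ((W ^~ w) \o (fun s : R => Num.min (T k w + `|s|) (T k.+1 w))).
  apply: (@continuous_comp_within R (W ^~ w) _ _ (@bm_continuous _ _ _ _ _ hW w) cm).
  by move=> s; rewrite /= in_itv/= andbT le_min addr_ge0//= (arrival_ge0 hN).
by move=> s; apply: cvgB; [exact: cc|exact: cvg_cst].
Qed.

Lemma measurable_stopped_path k :
  measurable_fun [set: stoppedType k.+1] (stopped_path k).
Proof.
apply: measurable_cpath_valued => s.
rewrite (_ : (fun _ => _) = (fun w =>
  W (Num.min (T k w + `|s|) (T k.+1 w)) w - W (T k w) w)); last first.
  by apply/funext => w; rewrite stopped_pathE.
apply: measurable_funB; apply: stopped_brownian.
(* The capped time is a stopping time: T_k + |s| <= u is already decided at time u - |s|, and is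
   impossible if that time is negative. *)
- move=> u u0; rewrite (_ : [set w | _] =
    [set w | T k w <= u - `|s|] `|` [set w | T k.+1 w <= u]).
    rewrite -filtrationE//; apply: measurableU; rewrite filtrationE//; last first.
      exact: filtration_arrival.
    have [us|us] := leP 0 (u - `|s|).
      apply: (filtration_mono (_ : u - `|s| <= u)); first by rewrite lerBlDr lerDl.
      exact: filtration_arrival.
    rewrite (_ : [set w | _] = set0).
      by have [] := filtration_sigma_algebra u0.
    apply/seteqP; split => w //= Tu.
    by have := le_lt_trans Tu us; rewrite ltNge (arrival_ge0 hN).
  apply/seteqP; split => w /=; rewrite ge_min lerBrDr.
    by move=> /orP.
  by move=> H; apply/orP.
- move=> w; rewrite ge_min lexx orbT andbT le_min addr_ge0 ?(arrival_ge0 hN)//.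
- by move=> u u0; exact: filtration_arrival.
- by move=> w; rewrite (arrival_ge0 hN)/= ltW// (rp_increasing hN).
Qed.

Variables eta theta sigma : R.

Lemma drawdown_step_stopped k w z b :
  drawdown_step eta theta sigma z b (step_data W T k w) =
  drawdown_step eta theta sigma z b (interarrival T k w, stopped_path k w).
Proof.
have tau0 := interarrival_gt0 hN k w.
have E s : s \in `[0, 1] -> segment eta theta sigma b (post_path W T k w) (s * interarrival T k w) =
    segment eta theta sigma b (stopped_path k w) (s * interarrival T k w).
  rewrite in_itv/= => /andP[s0 s1]; rewrite /segment stopped_pathE /post_path.
  rewrite (shifted_pathE (@bm_continuous _ _ _ _ _ hW)) ?(arrival_ge0 hN)//.
  rewrite min_l// ger0_norm ?mulr_ge0// ?(ltW tau0)//.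
  rewrite addrC -lerBrDr -/(interarrival T k w).
  by rewrite ler_piMl// ltW.
rewrite /drawdown_step /segment_sup /=; congr (_ - _); last first.
  by have := E 1; rewrite mul1r in_itv/= ler01 lexx; exact.
congr (Num.max _ (sup _)); apply/seteqP; split => y [s /= s01 <-]; exists s => //.
  by rewrite E.
by rewrite E.
Qed.

Lemma stopped_drawdown_step k (z b : Omega -> R) :
  measurable_fun [set: stoppedType k] z -> measurable_fun [set: stoppedType k] b ->
  measurable_fun [set: stoppedType k.+1]
    (fun w => drawdown_step eta theta sigma (z w) (b w) (step_data W T k w)).
Proof.
move=> mz mb; rewrite (_ : (fun _ => _) = (fun w =>
  drawdown_step eta theta sigma (z w) (b w) (interarrival T k w, stopped_path k w))).
  apply: measurable_drawdown_step.
  - exact: measurable_fun_stoppedS.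
  - exact: measurable_fun_stoppedS.
  - apply: measurable_funB; first exact: stopped_arrival.
    by apply: measurable_fun_stoppedS; exact: stopped_arrival.
  - exact: measurable_stopped_path.
by apply/funext => w; exact: drawdown_step_stopped.
Qed.

End stopped_measurability.

(** * Verification *)

Section verification.
Context d (Omega : measurableType d) (R : realType) (P : probability Omega R).
Variables (W : R -> Omega -> R) (N : R -> Omega -> nat) (T : nat -> Omega -> R).
Variables eta theta sigma crit r : R.
Hypothesis hW : standard_brownian_motion P W.
Hypothesis hN : renewal_process P N T.
Hypothesis hWN : indep_systems P (sigma_process W `[0, +oo[)
                           (sigma_process N `[0, +oo[).

Notation stoppedType k := (g_sigma_algebraType (stopped_sigma_algebra W N (T k))).
Notation X := (R * cpathType R)%type.

Let mstep k : measurable_fun setT (step_data W T k) := measurable_step_data hW hN k.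
Definition step_law : probability X R :=
  distribution P (mfun_Sub (mem_set (measurable_step_data hW hN 0))).

Let rho (x : X) : R := expR (- r * x.1).
Let Psi := @drawdown_step R eta theta sigma.
Let cost (z : R) : R := \1_[set y | crit < y] z.
Let discount k w : R := expR (- r * T k w).

Let rho0 x : 0 <= rho x. Proof. exact: expR_ge0. Qed.
Let cost0 z : 0 <= cost z. Proof. by rewrite /cost indicE. Qed.
Let discount0 k w : 0 <= discount k w. Proof. exact: expR_ge0. Qed.

Let mrho : measurable_fun setT rho.
Proof.
apply: measurableT_comp; first exact: measurable_expR.
by apply: measurable_funM; [exact: measurable_cst|exact: measurable_fst].
Qed.

Let mPsi z b : measurable_fun setT (Psi z b).
Proof.
rewrite (_ : Psi z b = fun x => Psi z b (x.1, x.2)); last by apply/funext => -[].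
apply: measurable_drawdown_step; [exact: measurable_cst|exact: measurable_cst| |].
  exact: measurable_fst.
exact: measurable_snd.
Qed.

Let mcost : measurable_fun setT cost.
Proof.
apply: measurable_indic; rewrite (_ : [set y | crit < y] = `]crit, +oo[%classic)//.
by apply/seteqP; split => y /=; rewrite in_itv/= andbT.
Qed.

Let cost_lsc z : \forall y \near z, cost z <= cost y.
Proof.
have [cz|zc] := ltP crit z; last first.
  near=> y; rewrite {1}/cost indicE memNset//=.
  by apply/negP; rewrite -leNgt.
have : \forall y \near z, crit < y by exact: lt_nbhsr.
apply: filterS => y cy; rewrite /cost !indicE ler_nat [in leqRHS]mem_set//.
exact: leq_b1.
Unshelve. all: by end_near. Qed.

Notation u_ := (value_iter step_law rho Psi cost).
Notation u := (value_limit step_law rho Psi cost).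
Notation cont := (continuation step_law rho Psi).

Let u_adm n : admissible_value (u_ n).
Proof.
apply: value_iter_admissible => //; exact: drawdown_step_continuous.
Qed.

Let u_adm' : admissible_value u.
Proof.
apply: value_limit_admissible => //; exact: drawdown_step_continuous.
Qed.

Let measurable_stopped_fun k d' (U : measurableType d') (f : Omega -> U) :
  measurable_fun [set: stoppedType k] f -> measurable_fun setT f.
Proof.
move=> mf _ B mB; rewrite setTI; have := mf measurableT B mB.
by rewrite setTI (stopped_typeE W hN); exact: stopped_measurable.
Qed.

Let measurable_integrand d' (U : measurableType d') (z b : U -> R)
    (v : R -> \bar R) :
  measurable_fun setT z -> measurable_fun setT b -> admissible_value v ->
  measurable_fun [set: U * X]
    (fun p => (rho p.2)%:E * v (Psi (z p.1) (b p.1) p.2))%E.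
Proof.
move=> mz mb av.
have m1 (f : U -> R) : measurable_fun setT f ->
    measurable_fun [set: U * X] (fun p => f p.1).
  by move=> mf; apply: measurableT_comp mf _; exact: measurable_fst.
apply: emeasurable_funM.
  apply/measurable_EFinP; apply: (measurableT_comp mrho); exact: measurable_snd.
apply: (measurableT_comp (lsc_measurable (av_lsc av))).
rewrite (_ : (fun _ => _) = (fun p : U * X =>
  Psi (z p.1) (b p.1) (p.2.1, p.2.2))); last by apply/funext => -[? []].
apply: measurable_drawdown_step.
- exact: (m1 z).
- exact: (m1 b).
- by apply: (measurableT_comp (f := fst)); [exact: measurable_fst|exact: measurable_snd].
- by apply: (measurableT_comp (f := snd)); [exact: measurable_snd|exact: measurable_snd].
Qed.

Lemma measurable_continuation (z b : Omega -> R) (v : R -> \bar R) :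
  measurable_fun setT z -> measurable_fun setT b -> admissible_value v ->
  measurable_fun setT (fun w => cont v (z w) (b w)).
Proof.
move=> mz mb av.
have h0 (p : Omega * X) : (0 <= (rho p.2)%:E * v (Psi (z p.1) (b p.1) p.2))%E.
  by rewrite mule_ge0 ?lee_fin// av_ge0.
exact: (@measurable_fun_fubini_tonelli_F _ _ _ _ R step_law _
  (measurable_integrand mz mb av) h0).
Qed.

(** The discount factor splits as the one at T_k times [rho] of the step data. All but the step data
    is known at T_k, and the step data is independent of that past. *)
Lemma discount_continuation k (z b : Omega -> R) (v : R -> \bar R) :
  measurable_fun [set: stoppedType k] z -> measurable_fun [set: stoppedType k] b ->
  admissible_value v ->
  (\int[P]_w ((discount k.+1 w)%:E * v (Psi (z w) (b w) (step_data W T k w))) =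
   \int[P]_w ((discount k w)%:E * cont v (z w) (b w)))%E.
Proof.
move=> mz mb av.
pose h (p : stoppedType k * X) : \bar R :=
  ((discount k p.1)%:E * ((rho p.2)%:E * v (Psi (z p.1) (b p.1) p.2)))%E.
transitivity (\int[P]_w h (w, step_data W T k w))%E.
  apply: eq_integral => w _; rewrite /h/= muleA -EFinM; congr (_%:E * _)%E.
  rewrite /discount /rho -expRD/= -mulrDr; congr (expR (_ * _)).
  by rewrite addrC /interarrival subrK.
rewrite (@integral_indep _ _ _ _ _ P step_law).
- apply: eq_integral => w _; rewrite /h/= ge0_integralZl//.
  + exact: measurable_continuation_integrand.
  + by move=> x _; rewrite mule_ge0 ?lee_fin// av_ge0.
  + by rewrite lee_fin.
- exact: stopped_measurable.
- exact: (stopped_sigma_algebraP W hN).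
- exact: mstep.
- by move=> A B sA mB; exact: (step_data_indep hW hN hWN).
- apply: emeasurable_funM; last exact: (@measurable_integrand _ (stoppedType k) z b v mz mb av).
  apply/measurable_EFinP.
  have md : measurable_fun [set: stoppedType k] (discount k).
    apply: measurableT_comp; first exact: measurable_expR.
    apply: measurable_funM; first exact: measurable_cst.
    exact: (stopped_arrival hN).
  by apply: (measurableT_comp md); exact: measurable_fst.
- by move=> p; rewrite /h !mule_ge0 ?lee_fin// av_ge0.
Qed.

(** * Expected cost along an arbitrary strategy *)

Section controlled.
Variables (b : nat -> Omega -> R) (z : R).
Hypothesis hb : admissible_controls W N T b.
Hypothesis z0 : 0 <= z.

Let B := fun t w => b (N t w) w.
Let D k w := drawdown W N T eta theta sigma B z (T k w) w.

Let b01 k w : 0 <= b k w <= 1. Proof. by case: hb. Qed.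

Lemma drawdown_at0 w : D 0 w = z.
Proof. by rewrite /D (rp_start hN) (drawdown_start W eta theta sigma hN)// max_l. Qed.

Lemma drawdown_atS k w : D k.+1 w = Psi (D k w) (b k w) (step_data W T k w).
Proof. exact: (drawdown_stepE _ _ _ hW hN). Qed.

Lemma control_stopped k : measurable_fun [set: stoppedType k] (b k).
Proof. by apply/(measurable_fun_stoppedP W hN); case: hb. Qed.

Lemma drawdown_stopped k : measurable_fun [set: stoppedType k] (D k).
Proof.
elim: k => [|k IH].
  rewrite (_ : D 0 = cst z); first exact: measurable_cst.
  by apply/funext => w; exact: drawdown_at0.
rewrite (_ : D k.+1 = fun w => Psi (D k w) (b k w) (step_data W T k w)).
  by apply: (stopped_drawdown_step hW hN) IH _; exact: control_stopped.
by apply/funext => w; exact: drawdown_atS.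
Qed.

Let c k : \bar R := (\int[P]_w (discount k w * cost (D k w))%:E)%E.
Let a k (v : R -> \bar R) : \bar R := (\int[P]_w ((discount k w)%:E * v (D k w)))%E.

Let mdiscount k : measurable_fun setT (discount k).
Proof.
apply: measurableT_comp; first exact: measurable_expR.
apply: measurable_funM; first exact: measurable_cst.
exact: (measurable_arrival hN).
Qed.

Let mD k : measurable_fun setT (D k).
Proof. exact: measurable_stopped_fun (@drawdown_stopped k). Qed.

Let c0 k : (0 <= c k)%E.
Proof. by apply: integral_ge0 => w _; rewrite lee_fin mulr_ge0. Qed.

Lemma strategy_value_series :
  strategy_value W N T eta theta sigma P crit r B z = (\sum_(k <oo) c k)%E.
Proof.
rewrite /strategy_value integral_nneseries// => k.
apply/measurable_EFinP; apply: measurable_funM; first exact: mdiscount.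
apply: measurable_indic; rewrite (_ : [set w | _] = D k @^-1` `]crit, +oo[%classic).
  by rewrite -[Y in measurable Y]setTI; exact: mD.
by apply/seteqP; split => w /=; rewrite in_itv/= andbT.
Qed.

(** Dynamic programming along the given strategy: with the control kept instead of the infimum, the
    integrand is compared below with the Bellman operator, from either side. *)
Lemma cost_split k (v : R -> \bar R) : admissible_value v ->
  (c k + a k.+1 v =
   \int[P]_w ((discount k w)%:E * ((cost (D k w))%:E + cont v (D k w) (b k w))))%E.
Proof.
move=> av.
have -> : a k.+1 v = (\int[P]_w ((discount k w)%:E * cont v (D k w) (b k w)))%E.
  rewrite -discount_continuation//; last 2 first.
  - exact: drawdown_stopped.
  - exact: control_stopped.
  by apply: eq_integral => w _; rewrite drawdown_atS.
rewrite -ge0_integralD//.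
- apply: eq_integral => w _.
  have h1 : (0 <= (cost (D k w))%:E)%E by rewrite lee_fin.
  have h2 : (0 <= cont v (D k w) (b k w))%E by exact: continuation_ge0.
  by rewrite (ge0_muleDr _ h1 h2) EFinM.
- by move=> w _; rewrite lee_fin mulr_ge0.
- apply/measurable_EFinP; apply: measurable_funM => //.
  exact: measurableT_comp mcost (@mD k).
- by move=> w _; rewrite mule_ge0 ?lee_fin//; exact: continuation_ge0.
- apply: emeasurable_funM; first exact/measurable_EFinP.
  by apply: measurable_continuation => //; exact: measurable_stopped_fun (@control_stopped k).
Qed.

Lemma le_cost_iter k n : (a k (u_ n.+1) <= c k + a k.+1 (u_ n))%E.
Proof.
rewrite cost_split//; apply: ge0_le_integral => //.
- by move=> w _; rewrite mule_ge0 ?lee_fin//; exact: (av_ge0 (u_adm n.+1)).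
- apply: emeasurable_funM; first exact/measurable_EFinP.
  exact: measurableT_comp (lsc_measurable (av_lsc (u_adm n.+1))) (@mD k).
- apply: emeasurable_funM; first exact/measurable_EFinP.
  apply: emeasurable_funD; last first.
    by apply: measurable_continuation => //; exact: measurable_stopped_fun (@control_stopped k).
  by apply/measurable_EFinP; exact: measurableT_comp mcost (@mD k).
- move=> w _; rewrite lee_wpmul2l ?lee_fin//; apply: leeD => //.
  by apply: ereal_inf_lbound; exists (b k w) => //=; rewrite in_itv/=.
Qed.

Let a0 v : a 0 v = v z.
Proof.
rewrite /a (eq_integral (fun=> v z)); last first.
  move=> w _; rewrite drawdown_at0 /discount (rp_start hN) mulr0 expR0 mul1e //.
have PT : (P : {measure set Omega -> \bar R}) setT = 1%E by exact: probability_setT.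
by rewrite integral_cst// PT mule1.
Qed.

Lemma value_limit_le_strategy :
  (u z <= strategy_value W N T eta theta sigma P crit r B z)%E.
Proof.
rewrite strategy_value_series.
(* The n-th iterate bounds from below the cost of the next n arrivals: [le_cost_iter] is applied n
   times, down to the iterate 0, which vanishes. *)
have H n k : (a k (u_ n) <= \sum_(k <= i < k + n) c i)%E.
  elim: n k => [|n IH] k.
    by rewrite addn0 big_geq// /a integral0_eq// => w _; rewrite mule0.
  apply: (le_trans (le_cost_iter k n)).
  rewrite addnS big_ltn ?ltnS ?leq_addr//; exact: leeD.
apply: ge_ereal_sup => _ [n _ <-]; rewrite -a0.
apply: (le_trans (H n 0%N)); rewrite add0n.
by apply: nneseries_lim_ge => i _ _; exact: c0.
Qed.

Lemma strategy_le_value_limit :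
  (forall k w, cont u (D k w) (b k w) =
     ereal_inf [set cont u (D k w) e | e in `[0, 1]%classic]) ->
  (strategy_value W N T eta theta sigma P crit r B z <= u z)%E.
Proof.
move=> opt; rewrite strategy_value_series.
have step k : (c k + a k.+1 u <= a k u)%E.
  rewrite cost_split//; apply: ge0_le_integral => //.
  - move=> w _; rewrite mule_ge0 ?lee_fin// adde_ge0// ?lee_fin//.
    exact: continuation_ge0.
  - apply: emeasurable_funM; first exact/measurable_EFinP.
    apply: emeasurable_funD; last first.
      by apply: measurable_continuation => //; exact: measurable_stopped_fun (@control_stopped k).
    by apply/measurable_EFinP; exact: measurableT_comp mcost (@mD k).
  - apply: emeasurable_funM; first exact/measurable_EFinP.
    exact: measurableT_comp (lsc_measurable (av_lsc u_adm')) (@mD k).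
  - move=> w _; rewrite lee_wpmul2l ?lee_fin// opt.
    by apply: bellman_limit_le => //; exact: drawdown_step_continuous.
(* The costs already paid plus the discounted remainder never exceed the initial value; the
   remainder is nonnegative and is dropped in the limit. *)
have H n : (\sum_(0 <= i < n) c i + a n u <= u z)%E.
  elim: n => [|n IH]; first by rewrite big_geq// add0e a0.
  apply: le_trans IH; rewrite big_nat_recr//= -addeA; exact: leeD.
apply: lime_le; first by apply: is_cvg_nneseries => i _ _; exact: c0.
apply: nearW => n; apply: le_trans (H n).
rewrite leeDl//; apply: integral_ge0 => w _.
by rewrite mule_ge0 ?lee_fin//; exact: (av_ge0 u_adm').
Qed.

End controlled.

(** * Markov strategy of a selector *)

Section markov_control.
Variables (bs : R -> R).
Hypothesis mbs : measurable_fun setT bs.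
Hypothesis bs01 : forall y, bs y \in `[0, 1].

(** The state is built from the step data alone, since defining it as the drawdown of the strategy
    would be circular: the strategy is read off the state. The two are identified by
    [markov_state_drawdown]. *)
Fixpoint markov_state (z : R) (k : nat) (w : Omega) : R :=
  if k is k'.+1
  then Psi (markov_state z k' w) (bs (markov_state z k' w)) (step_data W T k' w)
  else z.

Definition markov_control (z : R) (k : nat) (w : Omega) : R :=
  bs (markov_state z k w).

Lemma markov_state_stopped z k :
  measurable_fun [set: stoppedType k] (markov_state z k).
Proof.
elim: k => [|k IH]; first exact: measurable_cst.
apply: (stopped_drawdown_step hW hN) (IH) _.
exact: measurableT_comp mbs IH.
Qed.

Lemma markov_control_admissible z :
  admissible_controls W N T (markov_control z).
Proof.
split=> [k w|k]; first by have := bs01 (markov_state z k w); rewrite in_itv.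
apply/(measurable_fun_stoppedP W hN).
exact: measurableT_comp mbs (@markov_state_stopped z k).
Qed.

Lemma markov_state_drawdown z k w : 0 <= z ->
  drawdown W N T eta theta sigma (fun t w => markov_control z (N t w) w) z (T k w) w =
  markov_state z k w.
Proof.
move=> z0; have adm := markov_control_admissible z.
elim: k => [|k IH]; first exact: drawdown_at0.
rewrite [LHS](@drawdown_atS (markov_control z))//.
exact: (congr1 (fun y => Psi y (markov_control z k w) (step_data W T k w)) IH).
Qed.

End markov_control.

Lemma exists_value_selector : exists bs : R -> R,
  [/\ measurable_fun setT bs, forall y, bs y \in `[0, 1] &
   forall y, cont u y (bs y) = ereal_inf [set cont u y e | e in `[0, 1]%classic]].
Proof. by apply: exists_selector => //; exact: drawdown_step_continuous. Qed.

Lemma value_eq_limit z : 0 <= z -> value W N T eta theta sigma P crit r z = u z.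
Proof.
move=> z0; apply/eqP; rewrite eq_le; apply/andP; split; last first.
  apply: le_ereal_inf_tmp => _ [_ [b hb <-] <-].
  exact: value_limit_le_strategy.
have [bs [mbs bs01 bsE]] := exists_value_selector.
have adm := markov_control_admissible mbs bs01 z.
have le1 := strategy_le_value_limit adm z0 _.
apply: (@le_trans _ _ (strategy_value W N T eta theta sigma P crit r
    (fun t w => markov_control bs z (N t w) w) z)).
  apply: ereal_inf_lbound; exists (fun t w => markov_control bs z (N t w) w) => //.
  by exists (markov_control bs z).
apply: le1 => k w; rewrite (markov_state_drawdown mbs bs01)//.
Qed.

Lemma continuation_valueE z b : 0 <= z -> 0 <= b <= 1 ->
  continuation_value W N T eta theta sigma P crit r z b = cont u z b.
Proof.
move=> z0 b01; rewrite /continuation_value.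
pose X0 : {mfun Omega >-> X} := mfun_Sub (mem_set (measurable_step_data hW hN 0)).
have mi : measurable_fun setT (fun x => (rho x)%:E * u (Psi z b x))%E.
  exact: measurable_continuation_integrand.
rewrite /continuation /step_law ge0_integral_distribution//; last first.
  by move=> x; rewrite mule_ge0 ?lee_fin//; exact: (av_ge0 u_adm').
apply: eq_integral => w _ /=.
have -> : drawdown W N T eta theta sigma (fun=> (fun=> b)) z (T 1 w) w =
    Psi z b (step_data W T 0 w).
  rewrite (@drawdown_stepE _ _ _ P W N T eta theta sigma hW hN (fun=> (fun=> b)) w)//.
  by rewrite (rp_start hN) (drawdown_start W eta theta sigma hN)// max_l.
rewrite value_eq_limit//.
  by rewrite /rho /= /interarrival (rp_start hN) subr0.
(* [value_eq_limit] holds at nonnegative states. The new drawdown is one, because the supremum of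
   the segment includes its end value, at rescaled time 1. *)
rewrite /Psi /drawdown_step subr_ge0 le_max; apply/orP; right.
apply: ub_le_sup; first exact: (segment_has_sup _ _ _ _ _).2.
by exists 1; rewrite /= ?in_itv/= ?ler01 ?lexx ?mul1r.
Qed.

End verification.

Theorem theorem2p8 (R : realType) (disp : measure_display)
    (Omega : measurableType disp) (P : probability Omega R)
    (W : R -> Omega -> R) (N : R -> Omega -> nat) (T : nat -> Omega -> R)
    (eta theta sigma d r : R)
    (hP : measure_is_complete P)
    (hW : standard_brownian_motion P W)
    (hN : renewal_process P N T)
    (hWN : indep_systems P (sigma_process W `[0, +oo[)
                           (sigma_process N `[0, +oo[))
    (heta : eta < theta) (hsigma : 0 < sigma) (hd : 0 < d) (hr : 0 < r) :
  exists bstar : R -> R,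
    [/\ measurable_fun (`[0, +oo[ : set R) bstar,
        (forall z, 0 <= z -> bstar z \in `[0, 1]) &
        forall z, 0 <= z ->
          ereal_inf [set continuation_value W N T eta theta sigma P d r z b
                    | b in `[0, 1]]
          = continuation_value W N T eta theta sigma P d r z (bstar z)].
Proof.
have [bs [mbs bs01 bsE]] := exists_value_selector eta theta sigma d r hW hN.
exists bs; split=> [|z _|z z0].
- exact: measurable_funTS.
- exact: bs01.
have bz : 0 <= bs z <= 1 by have := bs01 z; rewrite in_itv.
rewrite (continuation_valueE _ _ _ _ _ hW hN hWN z0 bz) bsE.
congr ereal_inf; apply: eq_imagel => b /=; rewrite in_itv/= => b01.
exact: (continuation_valueE _ _ _ _ _ hW hN hWN z0 b01).
Qed.
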